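(* Let $\mathcal{F}$ be the class of locally univalent analytic functions $f(z)=z+\sum_{k=2}^\infty a_k z^k$ on the unit disk $\mathbb{D}$ satisfying $$\operatorname{Re}\left(1+\frac{zf''(z)}{f'(z)}\right)>-\frac12,\quad z\in\mathbb{D}.$$ Then for every $f\in\mathcal{F}$ and every $n\ge 1$, the section $s_n(f)(z)=z+\sum_{k=2}^n a_k z^k$ satisfies $$\operatorname{Re}\bigl(s_n(f)'(z)\bigr)>0\quad\text{for all } |z|<\tfrac13.$$ In particular, every section $s_n(f)$ of every $f\in\mathcal{F}$ is close-to-convex in the disk $|z|<1/3$. The radius $1/3$ cannot be replaced by a greater one: for every $r$ with $1/3<r\le 1$, it is not true that $\operatorname{Re}(s_n(f)'(z))>0$ in $|z|<r$ for all $f\in\mathcal{F}$ and all $n$, and it is not true that $s_n(f)$ is close-to-convex in $|z|<r$ for all $f\in\mathcal{F}$ and all $n$.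
   Context: $\mathbb{D}=\{z\in\mathbb{C}:|z|<1\}$. Locally univalent means $f'(z)\neq 0$ for all $z\in\mathbb{D}$. For $f(z)=z+\sum_{k=2}^\infty a_kz^k$ analytic in $\mathbb{D}$, the $n$-th section (partial sum) is the polynomial $s_n(f)(z)=z+\sum_{k=2}^n a_kz^k$ (with $s_1(f)(z)=z$). Let $\mathcal{C}$ be the class of functions $g$ analytic and univalent in $\mathbb{D}$ with $g(0)=0$, $g'(0)=1$, whose image $g(\mathbb{D})$ is convex. An analytic function $f$ on $\mathbb{D}$ with $f(0)=0$, $f'(0)=1$ is close-to-convex (in $\mathbb{D}$) if there exist $g\in\mathcal{C}$ and a real $\alpha$ with $|\alpha|<\pi/2$ such that $\operatorname{Re}\left(e^{i\alpha}f'(z)/g'(z)\right)>0$ for all $z\in\mathbb{D}$. A function $f$ analytic in $|z|<r$ with $f(0)=0$, $f'(0)=1$ is close-to-convex in the disk $|z|<r$ if $z\mapsto r^{-1}f(rz)$ is close-to-convex in $\mathbb{D}$. *)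

(* Defs.v *)
From Stdlib Require Import Reals.
From Coquelicot Require Import Coquelicot.

Open Scope R_scope.

(* [ex_derive] is complex differentiability, C being a normed module over
   itself.  [C_derive] is total, computed as a limit along a horizontal line; it
   is used below only at points where the function is complex differentiable, so
   that it is the complex derivative. *)
Definition analytic_in (r : R) (f : C -> C) : Prop :=
  forall z : C, Cmod z < r -> ex_derive f z.

Definition normalized_in (r : R) (f : C -> C) : Prop :=
  analytic_in r f /\ f 0 = 0 /\ C_derive f 0 = 1.

Definition univalent_in (r : R) (f : C -> C) : Prop :=
  forall z w : C, Cmod z < r -> Cmod w < r -> f z = f w -> z = w.

Definition locally_univalent (f : C -> C) : Prop :=
  forall z : C, Cmod z < 1 -> C_derive f z <> 0.

Definition convex_set (A : C -> Prop) : Prop :=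
  forall (u v : C) (t : R), A u -> A v -> 0 <= t <= 1 ->
    A ((1 - t)%R * u + t * v)%C.

Definition disk_image (f : C -> C) (w : C) : Prop :=
  exists z : C, Cmod z < 1 /\ w = f z.

Definition convex_class (g : C -> C) : Prop :=
  normalized_in 1 g /\ univalent_in 1 g /\ convex_set (disk_image g).

(* The complex number (cos alpha, sin alpha) is e^(i alpha).  Coquelicot's
   division is total with x / 0 = 0, so a zero of g' would violate the strict
   inequality rather than satisfy it. *)
Definition close_to_convex (f : C -> C) : Prop :=
  normalized_in 1 f /\
  exists (g : C -> C) (alpha : R),
    convex_class g /\ Rabs alpha < PI / 2 /\
    forall z : C, Cmod z < 1 ->
      0 < Re ((cos alpha, sin alpha) * (C_derive f z / C_derive g z))%C.

Definition close_to_convex_in (r : R) (f : C -> C) : Prop :=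
  normalized_in r f /\ close_to_convex (fun z : C => (/ r * f (r * z))%C).

(* [class_F f a]: f lies in the class F and f(z) = z + sum_(k >= 2) a_k z^k on
   the unit disk; the sequence a is determined by f. *)
Definition class_F (f : C -> C) (a : nat -> C) : Prop :=
  analytic_in 1 f /\
  a 0%nat = 0 /\ a 1%nat = 1 /\
  (forall z : C, Cmod z < 1 -> is_pseries a z (f z)) /\
  locally_univalent f /\
  forall z : C, Cmod z < 1 ->
    Re (1 + z * C_derive (C_derive f) z / C_derive f z)%C > - (1 / 2).

(* n-th partial sum z + sum_(2 <= k <= n) a_k z^k; the sum is empty for
   n <= 1. *)
Definition section (a : nat -> C) (n : nat) (z : C) : C :=
  (z + sum_n_m (fun k => a k * z ^ k) 2 n)%C.

(* Main.v *)
Require Import Defs.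
From Stdlib Require Import Reals Lra Lia Psatz.
From Coquelicot Require Import Coquelicot.

(* Let f be in F, f' = sum b_k z^k and Q = z f''/f' = sum d_j z^(j+1), so that
   Re Q > -3/2.  A function holomorphic in the disk whose real part is >= 0 on
   |z| = r has real part >= 0 at 0; applied to a holomorphic W with
   Re W = (Re Q + 3/2) (r^n - Re (kappa z^n)) on the circle, |kappa| = 1, this
   gives |d_j| <= 3.  Comparing coefficients in Q f' = z f'' yields
   (k+1) b_(k+1) = sum_(j <= k) d_j b_(k-j), whence
   |b_k| <= (k+1)(k+2)/2.  For the sections of f of degree at most 4, Re s_n' > 0
   in |z| < 1/3 is a polynomial inequality in d_0, d_1, d_2; for n >= 5, another one
   in d_0, ..., d_3 gives Re s_5' > 33/216 there, and
   33/216 = sum_(k >= 5) (k+1)(k+2)/2 3^(-k) dominates the remaining terms.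
   Sections are close-to-convex because g(z) = z is
   admissible.  Sharpness: for f' = (1 - z)^(-3), s_2'(z) = 1 + 3z vanishes at
   -1/3. *)

(** * Complex differentiation *)

(** The bounds on the b_k alone cannot give the result: at |z| = 1/3 they sum over k >= 1 to 27/8 -
    1 = 19/8 > 1. The low degrees therefore use the relations between the b_k. Since f' is the
    exponential of the sum of d_j z^(j+1) / (j+1), the derivative s_n' is that exponential truncated
    at weight n - 1, where d_j z^(j+1) has weight j + 1 and, by |d_j| <= 3, modulus at most 3^(-j)
    for |z| <= 1/3. So s_n' is a truncated exponential of u = d_0 z, with |u| <= 1, plus corrections
    that are small enough to be estimated by their moduli. The coefficient bounds are used only from
    degree 5 on, where they are small. *)

Lemma is_C_derive_eps (f : C -> C) (z l : C) :
  is_derive f z l <->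
  forall eps : R, 0 < eps -> exists delta : R, 0 < delta /\
    forall w : C, Cmod (w - z) < delta ->
      Cmod (f w - f z - (w - z) * l) <= eps * Cmod (w - z).
Proof.
split.
- intros [_ H] eps Heps.
  destruct (H z (fun P HP => HP) (mkposreal eps Heps)) as [d Hd].
  exists d; split; [apply cond_pos|]. intros w Hw; exact (Hd w Hw).
- intros H; split; [apply is_linear_scal_l|].
  intros x Hx eps.
  assert (Ex : z = x) by exact (is_filter_lim_locally_unique (V := AbsRing_NormedModule C_AbsRing) _ _ Hx).
  subst x.
  destruct (H eps (cond_pos eps)) as [d [Hd1 Hd2]].
  exists (mkposreal d Hd1); intros w Hw; exact (Hd2 w Hw).
Qed.

(* The general lemmas on products and compositions are stated with
   [AbsRing_NormedModule C_AbsRing], whose structure differs from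
   [C_NormedModule]. *)
Lemma is_C_derive_AbsRing (f : C -> C) (z l : C) :
  is_derive (V := AbsRing_NormedModule C_AbsRing) f z l <->
  is_derive (V := C_NormedModule) f z l.
Proof.
split; intros [H1 H2].
- split; [apply is_linear_scal_l | exact H2].
- split; [exact (is_linear_scal_l (K := C_AbsRing) (V := AbsRing_NormedModule C_AbsRing) l) | exact H2].
Qed.

(** Stated with [Cmod], so that it does not depend on which uniform structure of [C], the product
    one or that of the absolute ring, is inferred. *)
Definition C_continuous (f : C -> C) (z : C) : Prop :=
  forall eps : R, 0 < eps -> exists delta : R, 0 < delta /\
    forall w : C, Cmod (w - z) < delta -> Cmod (f w - f z) < eps.

Lemma C_continuous_alt (f : C -> C) (z : C) :
  C_continuous f z <->
  continuous (T := AbsRing_UniformSpace C_AbsRing)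
    (U := AbsRing_UniformSpace C_AbsRing) f z.
Proof.
split.
- intros H. apply filterlim_locally. intros eps.
  destruct (H eps (cond_pos eps)) as [d [Hd1 Hd2]].
  exists (mkposreal d Hd1); intros w Hw; exact (Hd2 w Hw).
- intros H eps Heps.
  destruct (proj1 (filterlim_locally _ _) H (mkposreal eps Heps)) as [d Hd].
  exists d; split; [apply cond_pos|]. intros w Hw; exact (Hd w Hw).
Qed.

Lemma is_derive_C_continuous (f : C -> C) (z l : C) :
  is_derive f z l -> C_continuous f z.
Proof.
intros H; apply C_continuous_alt.
apply (ex_derive_continuous (K := C_AbsRing) (V := AbsRing_NormedModule C_AbsRing)).
exists l; apply is_C_derive_AbsRing; exact H.
Qed.

Lemma C_continuous_plus (f g : C -> C) (z : C) :
  C_continuous f z -> C_continuous g z -> C_continuous (fun w => f w + g w)%C z.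
Proof.
intros Hf Hg; apply C_continuous_alt.
apply (continuous_plus (U := AbsRing_UniformSpace C_AbsRing) (K := C_AbsRing) (V := AbsRing_NormedModule C_AbsRing));
  apply C_continuous_alt; assumption.
Qed.

Lemma C_continuous_mult (f g : C -> C) (z : C) :
  C_continuous f z -> C_continuous g z -> C_continuous (fun w => f w * g w)%C z.
Proof.
intros Hf Hg; apply C_continuous_alt.
apply (continuous_mult (U := AbsRing_UniformSpace C_AbsRing) (K := C_AbsRing)); apply C_continuous_alt; assumption.
Qed.

Lemma C_continuous_const (c z : C) : C_continuous (fun _ => c) z.
Proof. apply C_continuous_alt, (continuous_const (U := AbsRing_UniformSpace C_AbsRing) (V := AbsRing_UniformSpace C_AbsRing)). Qed.

Lemma C_continuous_ext_disk (f g : C -> C) (z : C) (r : R) :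
  Cmod z < r -> (forall w, Cmod w < r -> f w = g w) ->
  C_continuous f z -> C_continuous g z.
Proof.
intros Hz He Hf eps Heps.
destruct (Hf eps Heps) as [d [Hd1 Hd2]].
exists (Rmin d (r - Cmod z)); split.
- apply Rmin_pos; lra.
- intros w Hw.
  rewrite <- !He; [apply Hd2| assumption |].
  + eapply Rlt_le_trans; [exact Hw | apply Rmin_l].
  + replace w with (w - z + z)%C by ring.
    eapply Rle_lt_trans; [apply Cmod_triangle|].
    assert (Rmin d (r - Cmod z) <= r - Cmod z) by apply Rmin_r. lra.
Qed.

Lemma is_C_derive_ext_disk (f g : C -> C) (z l : C) (r : R) :
  Cmod z < r -> (forall w, Cmod w < r -> f w = g w) ->
  is_derive f z l -> is_derive g z l.
Proof.
intros Hz He; apply is_derive_ext_loc.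
assert (Hp : 0 < r - Cmod z) by lra.
exists (mkposreal _ Hp); intros w Hw.
apply He.
change (Cmod (w - z) < r - Cmod z) in Hw.
replace w with (w - z + z)%C by ring.
eapply Rle_lt_trans; [apply Cmod_triangle|]. lra.
Qed.

Lemma is_C_derive_plus (f g : C -> C) (z k l : C) :
  is_derive f z k -> is_derive g z l ->
  is_derive (fun w => f w + g w)%C z (k + l)%C.
Proof. intros Hf Hg; exact (is_derive_plus _ _ _ _ _ Hf Hg). Qed.

Lemma is_C_derive_mult (f g : C -> C) (z k l : C) :
  is_derive f z k -> is_derive g z l ->
  is_derive (fun w => f w * g w)%C z (k * g z + f z * l)%C.
Proof.
intros Hf Hg; apply is_C_derive_AbsRing.
exact (is_derive_mult (K := C_AbsRing) f g z k l
  (proj2 (is_C_derive_AbsRing _ _ _) Hf) (proj2 (is_C_derive_AbsRing _ _ _) Hg) Cmult_comm).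
Qed.

Lemma is_C_derive_const (c z : C) : is_derive (fun _ : C => c) z (0 : C).
Proof. exact (is_derive_const (K := C_AbsRing) (V := C_NormedModule) c z). Qed.

Lemma is_C_derive_id (z : C) : is_derive (fun w : C => w) z (1 : C).
Proof. apply is_C_derive_AbsRing; exact (is_derive_id (K := C_AbsRing) z). Qed.

Lemma is_C_derive_comp (f g : C -> C) (z k l : C) :
  is_derive f (g z) k -> is_derive g z l ->
  is_derive (fun w => f (g w)) z (l * k)%C.
Proof.
intros Hf Hg.
exact (is_derive_comp (K := C_AbsRing) (V := C_NormedModule) f g z k l
  Hf (proj2 (is_C_derive_AbsRing _ _ _) Hg)).
Qed.

Lemma is_C_derive_pow (n : nat) (z : C) :
  is_derive (fun w : C => w ^ S n)%C z (INR (S n) * z ^ n)%C.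
Proof.
induction n as [|n IH].
- replace (INR 1 * z ^ 0)%C with (1 : C) by (simpl; ring).
  apply (is_derive_ext (fun w : C => w)).
  + intros t; symmetry; apply Cpow_1_r.
  + apply is_C_derive_id.
- replace (INR (S (S n)) * z ^ S n)%C
    with (1 * z ^ S n + z * (INR (S n) * z ^ n))%C.
  + exact (is_C_derive_mult _ _ _ _ _ (is_C_derive_id z) IH).
  + rewrite (S_INR (S n)), RtoC_plus, Cpow_S; ring.
Qed.

Lemma is_C_derive_inv (z : C) :
  z <> 0 -> is_derive (fun w : C => / w)%C z (- (/ z * / z))%C.
Proof.
intros Hz; apply is_C_derive_eps; intros eps Heps.
assert (Pz : 0 < Cmod z) by (apply Cmod_gt_0; exact Hz).
assert (P3 : 0 < Cmod z * Cmod z * Cmod z) by (repeat apply Rmult_lt_0_compat; lra).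
(* The first bound keeps |w| > |z|/2; the second absorbs the remainder (w - z)^2 / (w z^2), which is
   then at most 2 |w - z|^2 / |z|^3. *)
exists (Rmin (Cmod z / 2) (eps * (Cmod z * Cmod z * Cmod z) / 2)); split.
{ apply Rmin_pos; [lra|]. apply Rdiv_lt_0_compat; [|lra]. apply Rmult_lt_0_compat; lra. }
intros w Hw.
assert (H1 : Cmod (w - z) < Cmod z / 2) by (eapply Rlt_le_trans; [exact Hw | apply Rmin_l]).
assert (H2 : Cmod (w - z) < eps * (Cmod z * Cmod z * Cmod z) / 2)
  by (eapply Rlt_le_trans; [exact Hw | apply Rmin_r]).
assert (Hw2 : Cmod z / 2 < Cmod w).
{ assert (H := Cmod_triangle w (z - w)).
  replace (w + (z - w))%C with z in H by ring.
  replace (z - w)%C with (- (w - z))%C in H by ring.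
  rewrite Cmod_opp in H. lra. }
assert (Hw0 : w <> 0) by (apply Cmod_gt_0; lra).
replace (/ w - / z - (w - z) * - (/ z * / z))%C
  with ((w - z) * (w - z) * (/ w * / z * / z))%C by (field; split; assumption).
rewrite !Cmod_mult, !Cmod_inv by assumption.
assert (Hd := Cmod_ge_0 (w - z)).
rewrite (Rmult_comm eps), Rmult_assoc.
apply Rmult_le_compat_l; [exact Hd|].
apply Rle_trans with (eps * (Cmod z * Cmod z * Cmod z) / 2 * (/ (Cmod z / 2) * / Cmod z * / Cmod z)).
- apply Rmult_le_compat; [exact Hd| | lra |].
  + repeat apply Rmult_le_pos; left; apply Rinv_0_lt_compat; lra.
  + repeat apply Rmult_le_compat_r; try (left; apply Rinv_0_lt_compat; lra).
    apply Rinv_le_contravar; lra.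
- right; field; lra.
Qed.

(** Continuity of the derivative is included because the mean value property differentiates under
    the integral sign. Power series have it at once, their derivative being again a power series. *)
Definition holomorphic (f : C -> C) : Prop :=
  exists f' : C -> C, forall z : C, Cmod z < 1 ->
    is_derive f z (f' z) /\ C_continuous f' z.

Lemma holomorphic_const (c : C) : holomorphic (fun _ => c).
Proof.
exists (fun _ => RtoC 0); intros z _; split.
- apply is_C_derive_const.
- apply C_continuous_const.
Qed.

Lemma holomorphic_id : holomorphic (fun z => z).
Proof.
exists (fun _ => RtoC 1); intros z _; split.
- apply is_C_derive_id.
- apply C_continuous_const.
Qed.

Lemma holomorphic_plus (f g : C -> C) :
  holomorphic f -> holomorphic g -> holomorphic (fun z => f z + g z)%C.
Proof.
intros [f' Hf] [g' Hg]; exists (fun z => f' z + g' z)%C; intros z Hz.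
destruct (Hf z Hz), (Hg z Hz); split.
- apply is_C_derive_plus; assumption.
- apply C_continuous_plus; assumption.
Qed.

Lemma holomorphic_mult (f g : C -> C) :
  holomorphic f -> holomorphic g -> holomorphic (fun z => f z * g z)%C.
Proof.
intros [f' Hf] [g' Hg]; exists (fun z => f' z * g z + f z * g' z)%C; intros z Hz.
destruct (Hf z Hz), (Hg z Hz); split.
- apply is_C_derive_mult; assumption.
- apply C_continuous_plus; apply C_continuous_mult; try assumption;
    eapply is_derive_C_continuous; eassumption.
Qed.

Lemma holomorphic_pow (n : nat) : holomorphic (fun z => z ^ n)%C.
Proof.
induction n as [|n IH].
- exact (holomorphic_const 1).
- exact (holomorphic_mult _ _ holomorphic_id IH).
Qed.

Lemma holomorphic_inv (f : C -> C) :
  holomorphic f -> (forall z, Cmod z < 1 -> f z <> 0) ->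
  holomorphic (fun z => / f z)%C.
Proof.
intros [f' Hf] Hn; exists (fun z => f' z * - (/ f z * / f z))%C; intros z Hz.
destruct (Hf z Hz) as [H1 H2].
assert (H3 := is_C_derive_comp _ _ _ _ _ (is_C_derive_inv _ (Hn z Hz)) H1).
split; [exact H3|].
apply C_continuous_mult; [exact H2|].
assert (H4 : C_continuous (fun z => / f z)%C z)
  by (eapply is_derive_C_continuous; exact H3).
apply (C_continuous_ext_disk (fun z => (- (1)) * (/ f z * / f z))%C _ z 1 Hz).
- intros; ring.
- apply C_continuous_mult; [apply C_continuous_const|].
  apply C_continuous_mult; assumption.
Qed.

(** * The mean value property *)

Lemma Cmod_le_abs (x y : R) : Cmod (x, y) <= Rabs x + Rabs y.
Proof.
replace (x, y) with (RtoC x + RtoC y * Ci)%C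
  by (apply injective_projections; simpl; ring).
eapply Rle_trans; [apply Cmod_triangle|].
rewrite Cmod_mult, Cmod_Ci, !Cmod_R; lra.
Qed.

Lemma im_le_Cmod (z : C) : Rabs (Im z) <= Cmod z.
Proof. eapply Rle_trans; [|apply Rmax_Cmod]. apply Rmax_r. Qed.

Lemma Re_plus (a b : C) : Re (a + b)%C = Re a + Re b.
Proof. reflexivity. Qed.

Lemma Re_minus (a b : C) : Re (a - b)%C = Re a - Re b.
Proof. reflexivity. Qed.

Lemma Im_minus (a b : C) : Im (a - b)%C = Im a - Im b.
Proof. reflexivity. Qed.

Lemma Re_scal (x : R) (a : C) : Re (x * a)%C = x * Re a.
Proof. destruct a; unfold Re, Im; simpl; ring. Qed.

Lemma Im_scal (x : R) (a : C) : Im (x * a)%C = x * Im a.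
Proof. destruct a; unfold Re, Im; simpl; ring. Qed.

Lemma is_derive_eps (f : R -> R) (x l : R) :
  is_derive f x l <->
  forall eps : R, 0 < eps -> exists delta : R, 0 < delta /\
    forall y : R, Rabs (y - x) < delta ->
      Rabs (f y - f x - (y - x) * l) <= eps * Rabs (y - x).
Proof.
split.
- intros [_ H] eps Heps.
  destruct (H x (fun P HP => HP) (mkposreal eps Heps)) as [d Hd].
  exists d; split; [apply cond_pos|]. intros w Hw; exact (Hd w Hw).
- intros H; split; [apply is_linear_scal_l|].
  intros y Hy eps.
  assert (Ex : x = y) by exact (is_filter_lim_locally_unique (V := R_NormedModule) _ _ Hy). subst y.
  destruct (H eps (cond_pos eps)) as [d [Hd1 Hd2]].
  exists (mkposreal d Hd1); intros w Hw; exact (Hd2 w Hw).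
Qed.

Lemma is_derive_C_curve (f : C -> C) (l : C) (x y : R -> R) (s dx dy : R) :
  is_derive f (x s, y s) l -> is_derive x s dx -> is_derive y s dy ->
  is_derive (fun t => Re (f (x t, y t))) s (Re (l * (dx, dy))%C) /\
  is_derive (fun t => Im (f (x t, y t))) s (Im (l * (dx, dy))%C).
Proof.
intros Hf Hx Hy.
assert (Main : forall eps, 0 < eps -> exists delta, 0 < delta /\
  forall t, Rabs (t - s) < delta ->
    Cmod (f (x t, y t) - f (x s, y s) - RtoC (t - s) * (l * (dx, dy))) <= eps * Rabs (t - s)).
{ intros eps Heps.
  (* [M] bounds the speed: |G| <= M |t - s| as soon as e <= 1. The error is that of f, at most
     eps/(2M) |G|, plus l times the error [E] of the curve; [e] makes each part at most eps/2 |t -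
     s|. *)
  pose (M := Rabs dx + Rabs dy + 2).
  assert (HM : 2 <= M) by (unfold M; assert (H := Rabs_pos dx); assert (H' := Rabs_pos dy); lra).
  pose (L := Cmod l + 1).
  assert (HL : 1 <= L) by (unfold L; assert (H := Cmod_ge_0 l); lra).
  destruct (proj1 (is_C_derive_eps _ _ _) Hf (eps / (2 * M))) as [d0 [Hd0 H0]].
  { apply Rdiv_lt_0_compat; lra. }
  pose (e := Rmin 1 (eps / (4 * L))).
  assert (He : 0 < e) by (apply Rmin_pos; [lra | apply Rdiv_lt_0_compat; lra]).
  assert (He1 : e <= 1) by apply Rmin_l.
  assert (He2 : e <= eps / (4 * L)) by apply Rmin_r.
  destruct (proj1 (is_derive_eps _ _ _) Hx e He) as [d1 [Hd1 H1]].
  destruct (proj1 (is_derive_eps _ _ _) Hy e He) as [d2 [Hd2 H2]].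
  exists (Rmin (d0 / M) (Rmin d1 d2)); split.
  { repeat apply Rmin_pos; try assumption. apply Rdiv_lt_0_compat; lra. }
  intros t Ht.
  assert (T0 : Rabs (t - s) < d0 / M) by (eapply Rlt_le_trans; [exact Ht | apply Rmin_l]).
  assert (T12 : Rabs (t - s) < Rmin d1 d2) by (eapply Rlt_le_trans; [exact Ht | apply Rmin_r]).
  assert (T1 : Rabs (t - s) < d1) by (eapply Rlt_le_trans; [exact T12 | apply Rmin_l]).
  assert (T2 : Rabs (t - s) < d2) by (eapply Rlt_le_trans; [exact T12 | apply Rmin_r]).
  specialize (H1 t T1); specialize (H2 t T2).
  set (h := Rabs (t - s)) in *.
  assert (Hh : 0 <= h) by apply Rabs_pos.
  set (G := ((x t, y t) - (x s, y s))%C).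
  set (E := (G - RtoC (t - s) * (dx, dy))%C).
  assert (HE : Cmod E <= 2 * e * h).
  { unfold E, G.
    replace ((x t, y t) - (x s, y s) - RtoC (t - s) * (dx, dy))%C
      with (x t - x s - (t - s) * dx, y t - y s - (t - s) * dy)
      by (apply injective_projections; simpl; ring).
    eapply Rle_trans; [apply Cmod_le_abs|]. lra. }
  assert (HG : Cmod G <= M * h).
  { replace G with (E + RtoC (t - s) * (dx, dy))%C by (unfold E; ring).
    eapply Rle_trans; [apply Cmod_triangle|].
    rewrite Cmod_mult, Cmod_R. fold h.
    assert (H := Cmod_le_abs dx dy).
    assert (H' : h * Cmod (dx, dy) <= h * (Rabs dx + Rabs dy))
      by (apply Rmult_le_compat_l; assumption).
    assert (e * h <= 1 * h) by (apply Rmult_le_compat_r; assumption).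
    unfold M; lra. }
  assert (HG0 : Cmod G < d0).
  { eapply Rle_lt_trans; [exact HG|].
    apply Rlt_le_trans with (M * (d0 / M)); [apply Rmult_lt_compat_l; lra | right; field; lra]. }
  specialize (H0 (x t, y t) HG0). fold G in H0.
  replace (f (x t, y t) - f (x s, y s) - RtoC (t - s) * (l * (dx, dy)))%C
    with ((f (x t, y t) - f (x s, y s) - G * l) + l * E)%C by (unfold E; ring).
  eapply Rle_trans; [apply Cmod_triangle|]. rewrite Cmod_mult.
  assert (A1 : eps / (2 * M) * Cmod G <= eps / (2 * M) * (M * h))
    by (apply Rmult_le_compat_l; [left; apply Rdiv_lt_0_compat; lra | exact HG]).
  assert (A2 : Cmod l * Cmod E <= L * (2 * (eps / (4 * L)) * h)).
  { apply Rmult_le_compat; try apply Cmod_ge_0.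
    - unfold L; lra.
    - eapply Rle_trans; [exact HE|]. apply Rmult_le_compat_r; lra. }
  replace (eps / (2 * M) * (M * h)) with (eps / 2 * h) in A1 by (field; lra).
  replace (L * (2 * (eps / (4 * L)) * h)) with (eps / 2 * h) in A2 by (field; lra).
  lra. }
split; apply is_derive_eps; intros eps Heps;
  destruct (Main eps Heps) as [d [Hd H]]; exists d; (split; [exact Hd|]);
  intros t Ht; (eapply Rle_trans; [|exact (H t Ht)]).
- eapply Rle_trans; [|apply re_le_Cmod].
  rewrite !Re_minus, Re_scal; apply Rle_refl.
- eapply Rle_trans; [|apply im_le_Cmod].
  rewrite !Im_minus, Im_scal; apply Rle_refl.
Qed.

Lemma continuity_2d_pt_C_comp (f : C -> C) (x y : R -> R -> R) (u v : R) :
  C_continuous f (x u v, y u v) ->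
  continuity_2d_pt x u v -> continuity_2d_pt y u v ->
  continuity_2d_pt (fun a b => Re (f (x a b, y a b))) u v /\
  continuity_2d_pt (fun a b => Im (f (x a b, y a b))) u v.
Proof.
intros Hf Hx Hy.
assert (Main : forall eps : posreal, locally_2d (fun a b =>
  Cmod (f (x a b, y a b) - f (x u v, y u v)) < eps) u v).
{ intros eps. destruct (Hf eps (cond_pos eps)) as [d [Hd H]].
  assert (Hd2 : 0 < d / 2) by lra.
  generalize (Hx (mkposreal _ Hd2)) (Hy (mkposreal _ Hd2)); intros H1 H2.
  generalize (locally_2d_and _ _ _ _ H1 H2); apply locally_2d_impl.
  apply locally_2d_forall; simpl; intros a b [K1 K2].
  apply H.
  replace ((x a b, y a b) - (x u v, y u v))%C with (x a b - x u v, y a b - y u v)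
    by (apply injective_projections; simpl; ring).
  eapply Rle_lt_trans; [apply Cmod_le_abs|]. lra. }
split; intros eps; generalize (Main eps); apply locally_2d_impl;
  apply locally_2d_forall; intros a b Hab; (eapply Rle_lt_trans; [|exact Hab]).
- eapply Rle_trans; [|apply re_le_Cmod]. rewrite Re_minus; apply Rle_refl.
- eapply Rle_trans; [|apply im_le_Cmod]. rewrite Im_minus; apply Rle_refl.
Qed.

Definition polar (r t : R) : C := (r * cos t, r * sin t).

Lemma Cmod_polar (r t : R) : Cmod (polar r t) = Rabs r.
Proof.
unfold Cmod, polar; simpl.
replace (r * cos t * (r * cos t * 1) + r * sin t * (r * sin t * 1))
  with (r² * (Rsqr (sin t) + Rsqr (cos t))) by (unfold Rsqr; ring).
rewrite sin2_cos2, Rmult_1_r. apply sqrt_Rsqr_abs.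
Qed.

Section MeanValue.

Variables (W W' : C -> C).
Hypothesis HW : forall z : C, Cmod z < 1 -> is_derive W z (W' z) /\ C_continuous W' z.

Let u (r t : R) : R := Re (W (polar r t)).
Let du (r t : R) : R := Re (W' (polar r t) * (cos t, sin t)).

Lemma radial_derive (r t : R) : Rabs r < 1 -> is_derive (fun s => u s t) r (du r t).
Proof.
intros Hr.
apply (is_derive_C_curve W (W' (polar r t)) (fun s => s * cos t) (fun s => s * sin t)).
- apply HW. fold (polar r t); rewrite Cmod_polar; exact Hr.
- auto_derive; [trivial | ring].
- auto_derive; [trivial | ring].
Qed.

(** The second half is the Cauchy-Riemann equation in polar coordinates: the velocity of the circle
    is i r e^(it), and Im (i w) = Re w. The first half serves for the continuity of [u r] in the
    angle. *)
Lemma angular_derive (r t : R) : Rabs r < 1 ->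
  is_derive (fun s => u r s) t (Re (W' (polar r t) * (- (r * sin t), r * cos t)%R)%C) /\
  is_derive (fun s => Im (W (polar r s))) t (r * du r t).
Proof.
intros Hr.
destruct (is_derive_C_curve W (W' (polar r t)) (fun s => r * cos s) (fun s => r * sin s)
  t (- (r * sin t)) (r * cos t)) as [H1 H2].
- apply HW. fold (polar r t); rewrite Cmod_polar; exact Hr.
- auto_derive; [trivial | ring].
- auto_derive; [trivial | ring].
- split; [exact H1|].
  replace (r * du r t) with (Im (W' (polar r t) * (- (r * sin t), r * cos t)%R)%C); [exact H2|].
  unfold du; destruct (W' (polar r t)); unfold Re, Im; simpl; ring.
Qed.

Lemma continuity_2d_pt_radial (r t : R) : Rabs r < 1 -> continuity_2d_pt du r t.
Proof.
intros Hr.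
assert (Cc : continuity_2d_pt (fun _ b => cos b) r t).
{ apply (continuity_1d_2d_pt_comp cos (fun _ b => b)).
  - apply continuity_cos.
  - apply continuity_2d_pt_id2. }
assert (Cs : continuity_2d_pt (fun _ b => sin b) r t).
{ apply (continuity_1d_2d_pt_comp sin (fun _ b => b)).
  - apply continuity_sin.
  - apply continuity_2d_pt_id2. }
destruct (continuity_2d_pt_C_comp W' (fun a b => a * cos b) (fun a b => a * sin b) r t) as [H1 H2].
- apply HW. fold (polar r t); rewrite Cmod_polar; exact Hr.
- apply continuity_2d_pt_mult; [apply continuity_2d_pt_id1 | exact Cc].
- apply continuity_2d_pt_mult; [apply continuity_2d_pt_id1 | exact Cs].
- apply (continuity_2d_pt_ext (fun a b => Re (W' (polar a b)) * cos b - Im (W' (polar a b)) * sin b)).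
  + intros a b; unfold du; destruct (W' (polar a b)); unfold Re, Im; simpl; ring.
  + apply continuity_2d_pt_minus; apply continuity_2d_pt_mult; assumption.
Qed.

Lemma ex_RInt_circle (r : R) : Rabs r < 1 -> ex_RInt (u r) 0 (2 * PI).
Proof.
intros Hr. apply (ex_RInt_continuous (V := R_CompleteNormedModule)); intros t _.
apply (ex_derive_continuous (K := R_AbsRing) (V := R_NormedModule)).
eexists; exact (proj1 (angular_derive r t Hr)).
Qed.

(** By Cauchy-Riemann the integrand is the angular derivative of Im W / r, which takes the same
    value at both ends of the period. *)
Lemma RInt_radial (r : R) : 0 < r < 1 -> RInt (du r) 0 (2 * PI) = 0.
Proof.
intros Hr.
assert (Ha : Rabs r < 1) by (rewrite Rabs_pos_eq; lra).
apply is_RInt_unique.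
replace 0 with (minus (/ r * Im (W (polar r (2 * PI))))
                  (/ r * Im (W (polar r 0)))) at 2.
- apply (is_RInt_derive (V := R_CompleteNormedModule) (fun t => / r * Im (W (polar r t))) (du r)).
  + intros t _. assert (E : / r * (r * du r t) = du r t) by (field; lra).
    rewrite <- E.
    apply is_derive_scal. exact (proj2 (angular_derive r t Ha)).
  + intros t _. 
    intros P HP.
    destruct HP as [e He].
    destruct (locally_2d_1d_const_x _ _ _ (continuity_2d_pt_radial r t Ha e)) as [d Hd].
    exists d; intros y Hy; exact (He _ (Hd y Hy)).
- unfold polar; rewrite cos_2PI, sin_2PI, cos_0, sin_0. apply Rminus_diag_eq; reflexivity.
Qed.

Lemma RInt_circle_derive (r : R) : Rabs r < 1 ->
  is_derive (fun s => RInt (u s) 0 (2 * PI)) r (RInt (du r) 0 (2 * PI)).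
Proof.
intros Hr.
assert (Hloc : locally r (fun s => Rabs s < 1)).
{ assert (Hp : 0 < 1 - Rabs r) by lra.
  assert (Hs : forall s, Rabs (s - r) < 1 - Rabs r -> Rabs s < 1).
  { intros s Hs. assert (H := Rabs_triang (s - r) r).
    replace (s - r + r) with s in H by ring. lra. }
  exists (mkposreal _ Hp); exact Hs. }
assert (HD : forall s t, Rabs s < 1 -> Derive (fun z => u z t) s = du s t)
  by (intros; apply is_derive_unique, radial_derive; assumption).
rewrite (RInt_ext (du r) (fun t => Derive (fun z => u z t) r))
  by (intros; symmetry; apply HD; exact Hr).
apply (is_derive_RInt_param u).
- revert Hloc; apply filter_imp; intros s Hs t _.
  eexists; apply radial_derive; exact Hs.
- intros t _. apply (continuity_2d_pt_ext_loc du).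
  + destruct Hloc as [d Hd]; exists d; intros a b Ha _.
    symmetry; apply HD, Hd; exact Ha.
  + apply continuity_2d_pt_radial; exact Hr.
- revert Hloc; apply filter_imp; intros s Hs. apply ex_RInt_circle; exact Hs.
Qed.

Lemma mean_value (r : R) : 0 <= r < 1 ->
  RInt (u r) 0 (2 * PI) = 2 * PI * Re (W 0).
Proof.
intros Hr.
transitivity (RInt (u 0) 0 (2 * PI)).
- destruct (Rle_lt_or_eq_dec 0 r (proj1 Hr)) as [Hp|<-]; [|reflexivity].
  assert (Hb : forall x, 0 <= x <= r -> Rabs x < 1)
    by (intros x Hx; rewrite Rabs_pos_eq; lra).
  (* The derivative is known to vanish only for positive radii, since [RInt_radial] divides by the
     radius; at radius 0 continuity is enough. *)
  destruct (MVT_gen (fun s => RInt (u s) 0 (2 * PI)) 0 r (fun _ => 0)) as [c [_ Hc]].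
  + rewrite Rmin_left, Rmax_right by lra. intros x Hx.
    assert (E := RInt_circle_derive x ltac:(apply Hb; lra)).
    rewrite RInt_radial in E by lra. exact E.
  + rewrite Rmin_left, Rmax_right by lra. intros x Hx.
    apply continuity_pt_filterlim.
    apply (ex_derive_continuous (K := R_AbsRing) (V := R_NormedModule)
      (fun s => RInt (u s) 0 (2 * PI)) x).
    eexists; apply RInt_circle_derive, Hb; exact Hx.
  + lra.
- rewrite (RInt_ext _ (fun _ => Re (W 0))).
  + rewrite RInt_const. change ((2 * PI - 0) * Re (W 0) = 2 * PI * Re (W 0)). ring.
  + intros t _; unfold u. unfold polar; rewrite !Rmult_0_l; reflexivity.
Qed.

End MeanValue.

Lemma Re_center_nonneg (W : C -> C) (r : R) :
  holomorphic W -> 0 <= r < 1 ->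
  (forall z : C, Cmod z = r -> 0 <= Re (W z)) -> 0 <= Re (W 0).
Proof.
intros [W' HW] Hr Hpos.
assert (H := mean_value W W' HW r Hr).
assert (H0 : 0 <= RInt (fun t => Re (W (polar r t))) 0 (2 * PI)).
{ apply RInt_ge_0.
  - assert (P := PI_RGT_0); lra.
  - apply (ex_RInt_circle W W' HW). rewrite Rabs_pos_eq; lra.
  - intros t _. apply Hpos. rewrite Cmod_polar. apply Rabs_pos_eq; lra. }
rewrite H in H0. assert (P := PI_RGT_0).
apply Rmult_le_reg_l with (2 * PI); lra.
Qed.

(** * Power series *)

Lemma sum_n_C (u : nat -> C) (n : nat) :
  sum_n u n = (sum_n (fun k => Re (u k)) n, sum_n (fun k => Im (u k)) n).
Proof.
induction n as [|n IH].
- rewrite !sum_O. apply surjective_pairing.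
- rewrite !sum_Sn, IH. reflexivity.
Qed.

Lemma is_series_C (u : nat -> C) (l : C) :
  is_series u l <->
  is_series (fun k => Re (u k)) (Re l) /\ is_series (fun k => Im (u k)) (Im l).
Proof.
split.
- intros H; split.
  + apply (filterlim_ext (fun n => fst (sum_n u n))).
    * intros n; rewrite sum_n_C; reflexivity.
    * eapply filterlim_comp; [exact H | apply continuous_fst].
  + apply (filterlim_ext (fun n => snd (sum_n u n))).
    * intros n; rewrite sum_n_C; reflexivity.
    * eapply filterlim_comp; [exact H | apply continuous_snd].
- intros [H1 H2].
  apply (filterlim_ext (fun n => (sum_n (fun k => Re (u k)) n, sum_n (fun k => Im (u k)) n))).
  + intros n; symmetry; apply sum_n_C.
  + intros P [eps HP].
    generalize (proj1 (filterlim_locally _ _) H1 eps) (proj1 (filterlim_locally _ _) H2 eps).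
    intros [N1 K1] [N2 K2]; exists (Nat.max N1 N2); intros n Hn.
    apply HP; split; [apply K1 | apply K2]; lia.
Qed.

Lemma is_series_C_unique (u : nat -> C) (l m : C) :
  is_series u l -> is_series u m -> l = m.
Proof.
intros H1 H2; apply is_series_C in H1; apply is_series_C in H2.
destruct H1 as [A1 B1], H2 as [A2 B2]. apply injective_projections.
- exact (eq_trans (eq_sym (is_series_unique _ _ A1)) (is_series_unique _ _ A2)).
- exact (eq_trans (eq_sym (is_series_unique _ _ B1)) (is_series_unique _ _ B2)).
Qed.

Lemma Cmod_sum_n_m (u : nat -> C) (m n : nat) :
  Cmod (sum_n_m u m n) <= sum_n_m (fun k => Cmod (u k)) m n.
Proof. exact (norm_sum_n_m (K := C_AbsRing) (V := C_NormedModule) u m n). Qed.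

Lemma Cmod_series_le (u : nat -> C) (v : nat -> R) (l : C) (s : R) :
  is_series u l -> (forall k, Cmod (u k) <= v k) -> is_series v s -> Cmod l <= s.
Proof.
intros Hu Huv Hv.
assert (L1 : is_lim_seq (fun n => Cmod (sum_n u n)) (Cmod l)).
{ eapply filterlim_comp; [exact Hu |].
  exact (filterlim_norm (K := C_AbsRing) (V := C_NormedModule) l). }
assert (L2 : is_lim_seq (fun n => sum_n v n) s) by exact Hv.
refine (is_lim_seq_le _ _ _ _ _ L1 L2).
intros n; eapply Rle_trans; [apply Cmod_sum_n_m|].
apply sum_n_m_le; exact Huv.
Qed.

(** Says that the radius of convergence is at least 1, in a form that passes to shifts, linear
    combinations and termwise derivatives. *)
Definition abs_conv (a : nat -> C) : Prop :=
  forall r : R, 0 <= r < 1 -> ex_series (fun k => Cmod (a k) * r ^ k).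

(** A total function, built from the real [Series] of the two components; [CPS_correct] tells when
    it is the complex sum. *)
Definition CPS (a : nat -> C) (z : C) : C :=
  (Series (fun k => Re (a k * z ^ k)%C), Series (fun k => Im (a k * z ^ k)%C)).

Lemma CPS_correct (a : nat -> C) (z : C) :
  abs_conv a -> Cmod z < 1 -> is_series (fun k => a k * z ^ k)%C (CPS a z).
Proof.
intros Ha Hz.
assert (H := Ha (Cmod z) (conj (Cmod_ge_0 z) Hz)).
assert (E : forall k, Cmod (a k * z ^ k)%C = Cmod (a k) * Cmod z ^ k)
  by (intros; rewrite Cmod_mult, Cmod_pow; reflexivity).
apply is_series_C; split; apply Series_correct;
  refine (ex_series_le (K := R_AbsRing) (V := R_CompleteNormedModule) _ _ _ H);
  intros k; rewrite <- E; [apply re_le_Cmod | apply im_le_Cmod].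
Qed.

Lemma CPS_unique (a : nat -> C) (z l : C) :
  abs_conv a -> Cmod z < 1 -> is_series (fun k => a k * z ^ k)%C l -> CPS a z = l.
Proof.
intros Ha Hz; apply is_series_C_unique, CPS_correct; assumption.
Qed.

Lemma pow_n_Cpow (z : C) (k : nat) : pow_n z k = (z ^ k)%C.
Proof.
induction k as [|k IH]; [reflexivity|].
rewrite Cpow_S, <- IH; reflexivity.
Qed.

Lemma is_pseries_C (a : nat -> C) (z l : C) :
  is_pseries a z l <-> is_series (fun k => a k * z ^ k)%C l.
Proof.
unfold is_pseries.
assert (E : forall k, scal (pow_n z k) (a k) = (a k * z ^ k)%C)
  by (intros k; exact (eq_trans (f_equal (fun w => Cmult w (a k)) (pow_n_Cpow z k)) (Cmult_comm _ _))).
split; apply is_series_ext; intros k; [|symmetry]; apply E.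
Qed.

Lemma abs_conv_shift (a : nat -> C) : abs_conv a -> abs_conv (fun k => a (S k)).
Proof.
intros Ha r Hr.
destruct (Req_dec r 0) as [->|Hr0].
- exists (Cmod (a 1%nat)).
  apply (is_series_ext (fun k => scal (pow_n 0 k) (Cmod (a (S k))))).
  + intros k. rewrite pow_n_pow. apply Rmult_comm.
  + apply (is_pseries_0 (K := R_AbsRing) (V := R_NormedModule) (fun k => Cmod (a (S k)))).
- assert (H := proj1 (ex_series_incr_1 _) (Ha r Hr)).
  apply (ex_series_scal (/ r)) in H. revert H; apply ex_series_ext.
  intros k. change (/ r * (Cmod (a (S k)) * r ^ S k) = Cmod (a (S k)) * r ^ k).
  simpl; field; exact Hr0.
Qed.

Lemma is_series_C_decr (u : nat -> C) (l : C) :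
  is_series (fun k => u (S k)) (l - u 0%nat)%C -> is_series u l.
Proof. exact (is_series_decr_1 (K := C_AbsRing) (V := C_NormedModule) u l). Qed.

Lemma is_series_C_scal (c : C) (u : nat -> C) (l : C) :
  is_series u l -> is_series (fun k => c * u k)%C (c * l)%C.
Proof. exact (is_series_scal (K := C_AbsRing) (V := C_NormedModule) c u l). Qed.

Lemma is_series_C_plus (u v : nat -> C) (l m : C) :
  is_series u l -> is_series v m -> is_series (fun k => u k + v k)%C (l + m)%C.
Proof. exact (is_series_plus (K := C_AbsRing) (V := C_NormedModule) u v l m). Qed.

Lemma is_series_R_decr (u : nat -> R) (l : R) :
  is_series (fun k => u (S k)) (l - u 0%nat) -> is_series u l.
Proof. exact (is_series_decr_1 (K := R_AbsRing) (V := R_NormedModule) u l). Qed.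

Lemma CPS_decr (a : nat -> C) (z : C) :
  abs_conv a -> Cmod z < 1 -> CPS a z = (a 0%nat + z * CPS (fun k => a (S k)) z)%C.
Proof.
intros Ha Hz. apply CPS_unique; try assumption.
apply is_series_C_decr.
replace (a 0%nat + z * CPS (fun k => a (S k)) z - a 0%nat * z ^ 0)%C
  with (z * CPS (fun k => a (S k)) z)%C by (simpl; ring).
assert (H := is_series_C_scal z _ _ (CPS_correct _ z (abs_conv_shift a Ha) Hz)).
revert H; apply is_series_ext. intros k. rewrite Cpow_S.
change (z * (a (S k) * z ^ k) = a (S k) * (z * z ^ k))%C. ring.
Qed.

Lemma abs_conv_linear (a b : nat -> C) (c : C) :
  abs_conv a -> abs_conv b -> abs_conv (fun k => a k + c * b k)%C.
Proof.
intros Ha Hb r Hr.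
assert (H := ex_series_plus _ _ (Ha r Hr) (ex_series_scal (Cmod c) _ (Hb r Hr))).
refine (ex_series_le (K := R_AbsRing) (V := R_CompleteNormedModule) _ _ _ H).
intros k. assert (Hp : 0 <= r ^ k) by (apply pow_le; lra).
change (Rabs (Cmod (a k + c * b k) * r ^ k)
  <= Cmod (a k) * r ^ k + Cmod c * (Cmod (b k) * r ^ k)).
rewrite Rabs_pos_eq by (apply Rmult_le_pos; [apply Cmod_ge_0 | exact Hp]).
assert (T := Cmod_triangle (a k) (c * b k)). rewrite Cmod_mult in T.
apply Rle_trans with ((Cmod (a k) + Cmod c * Cmod (b k)) * r ^ k).
- apply Rmult_le_compat_r; assumption.
- right; ring.
Qed.

Lemma CPS_linear (a b : nat -> C) (c z : C) :
  abs_conv a -> abs_conv b -> Cmod z < 1 ->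
  CPS (fun k => a k + c * b k)%C z = (CPS a z + c * CPS b z)%C.
Proof.
intros Ha Hb Hz. apply CPS_unique; [apply abs_conv_linear; assumption | exact Hz|].
assert (H := is_series_C_plus _ _ _ _ (CPS_correct a z Ha Hz)
  (is_series_C_scal c _ _ (CPS_correct b z Hb Hz))).
revert H; apply is_series_ext. intros k.
change (a k * z ^ k + c * (b k * z ^ k) = (a k + c * b k) * z ^ k)%C. ring.
Qed.

(** Gives access to [CV_radius_derive] for the termwise derivative. A radius s < 1 is refuted at the
    midpoint (s + 1) / 2, where the terms would not tend to 0. *)
Lemma abs_conv_CV_radius (a : nat -> C) :
  abs_conv a -> Rbar_le 1 (CV_radius (fun k => Cmod (a k))).
Proof.
intros Ha. apply Rbar_not_lt_le; intros H.
set (R0 := CV_radius (fun k => Cmod (a k))) in H.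
assert (P : Rbar_le 0 R0) by apply CV_radius_ge_0.
destruct R0 as [s| |] eqn:E; simpl in H, P; try contradiction.
assert (Hr : 0 <= (s + 1) / 2 < 1) by lra.
apply (CV_disk_outside (fun k => Cmod (a k)) ((s + 1) / 2)).
- fold R0; rewrite E. simpl. rewrite Rabs_pos_eq; lra.
- apply ex_series_lim_0, Ha; exact Hr.
Qed.

Definition CPS_derive (a : nat -> C) (k : nat) : C := (INR (S k) * a (S k))%C.

Lemma Cmod_INR (n : nat) : Cmod (INR n) = INR n.
Proof. rewrite Cmod_R; apply Rabs_pos_eq, pos_INR. Qed.

Lemma abs_conv_derive (a : nat -> C) : abs_conv a -> abs_conv (CPS_derive a).
Proof.
intros Ha r Hr.
assert (H : ex_series (fun k => Rabs (PS_derive (fun k => Cmod (a k)) k * r ^ k))).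
{ apply CV_disk_inside. rewrite CV_radius_derive.
  apply Rbar_lt_le_trans with 1; [simpl; rewrite Rabs_pos_eq; lra|].
  apply abs_conv_CV_radius; exact Ha. }
revert H; apply ex_series_ext. intros k.
unfold PS_derive, CPS_derive. rewrite Cmod_mult, Cmod_INR.
apply Rabs_pos_eq. repeat apply Rmult_le_pos; try apply Cmod_ge_0; try apply pos_INR.
apply pow_le; lra.
Qed.

(** If E_n is the remainder for the exponent n, then E_(n+1) = w E_n + n z^(n-1) (w - z)^2. The
    constant is the second derivative of x^(k+2) at rho, without the factor 1/2, so that summing the
    bounds gives a twice derived power series. *)
Lemma Cpow_taylor_bound (z w : C) (rho : R) (k : nat) :
  Cmod z <= rho -> Cmod w <= rho ->
  Cmod (w ^ S (S k) - z ^ S (S k) - INR (S (S k)) * z ^ S k * (w - z))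
  <= INR (S (S k)) * INR (S k) * rho ^ k * (Cmod (w - z) * Cmod (w - z)).
Proof.
intros Hz Hw.
assert (Hrho : 0 <= rho) by (eapply Rle_trans; [apply Cmod_ge_0 | exact Hz]).
set (h2 := Cmod (w - z) * Cmod (w - z)).
assert (Hh : 0 <= h2) by (apply Rmult_le_pos; apply Cmod_ge_0).
induction k as [|k IH].
- replace (w ^ 2 - z ^ 2 - INR 2 * z ^ 1 * (w - z))%C with ((w - z) * (w - z))%C
    by (replace (INR 2) with 2 by (simpl; ring); simpl; ring).
  rewrite Cmod_mult; fold h2. simpl. lra.
- replace (w ^ S (S (S k)) - z ^ S (S (S k)) - INR (S (S (S k))) * z ^ S (S k) * (w - z))%C
    with (w * (w ^ S (S k) - z ^ S (S k) - INR (S (S k)) * z ^ S k * (w - z))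
          + INR (S (S k)) * z ^ S k * ((w - z) * (w - z)))%C
    by (rewrite (S_INR (S (S k))), RtoC_plus, (Cpow_S w (S (S k))), (Cpow_S z (S (S k))),
          (Cpow_S z (S k)); ring).
  eapply Rle_trans; [apply Cmod_triangle|].
  rewrite (Cmod_mult w), (Cmod_mult (INR (S (S k)) * z ^ S k)), (Cmod_mult (w - z)), Cmod_mult,
    Cmod_INR, Cmod_pow.
  fold h2.
  assert (A1 : Cmod w * Cmod (w ^ S (S k) - z ^ S (S k) - INR (S (S k)) * z ^ S k * (w - z))
    <= rho * (INR (S (S k)) * INR (S k) * rho ^ k * h2))
    by (apply Rmult_le_compat; try apply Cmod_ge_0; assumption).
  assert (A2 : INR (S (S k)) * Cmod z ^ S k * h2 <= INR (S (S k)) * rho ^ S k * h2).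
  { apply Rmult_le_compat_r; [exact Hh|]. apply Rmult_le_compat_l; [apply pos_INR|].
    apply pow_incr; split; [apply Cmod_ge_0 | exact Hz]. }
  assert (A3 : 0 <= INR (S (S k)) * rho ^ S k * h2)
    by (apply Rmult_le_pos; [apply Rmult_le_pos;
      [apply pos_INR | apply pow_le; exact Hrho] | exact Hh]).
  replace (INR (S (S (S k))) * INR (S (S k)) * rho ^ S k * h2)
    with ((INR (S k) + 2) * (INR (S (S k)) * rho ^ S k * h2))
    by (rewrite (S_INR (S (S k))), (S_INR (S k)); ring).
  replace (rho * (INR (S (S k)) * INR (S k) * rho ^ k * h2))
    with (INR (S k) * (INR (S (S k)) * rho ^ S k * h2)) in A1 by (simpl; ring).
  lra.
Qed.

(** The first-order remainder is summed term by term: with z and w in a disk of radius rho < 1, it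
    is at most K |w - z|^2, where K is the second termwise derivative of the series of moduli at
    rho. *)
Lemma is_derive_CPS (a : nat -> C) (z : C) :
  abs_conv a -> Cmod z < 1 -> is_derive (CPS a) z (CPS (CPS_derive a) z).
Proof.
intros Ha Hz.
pose (rho := (Cmod z + 1) / 2).
assert (P := Cmod_ge_0 z).
assert (Hrho : 0 <= rho < 1) by (unfold rho; lra).
(* Terms of degree 0 and 1 have no remainder, hence the value 0 there. *)
pose (M (k : nat) := match k with S (S j) => INR (S (S j)) * INR (S j) * rho ^ j * Cmod (a k) | _ => 0 end).
assert (HM : exists K : R, is_series M K).
{ destruct (abs_conv_derive _ (abs_conv_derive _ Ha) rho Hrho) as [K HK]; exists K.
  apply is_series_R_decr, is_series_R_decr.
  unfold M at 2 3; rewrite !Rminus_0_r.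
  revert HK; apply is_series_ext. intros k.
  unfold CPS_derive, M. rewrite !Cmod_mult, !Cmod_INR.
  match goal with |- ?x = ?y => change (x = y :> R) end. ring. }
destruct HM as [K HM].
assert (HK0 := Rabs_pos K).
apply is_C_derive_eps; intros eps Heps.
exists (Rmin ((1 - Cmod z) / 2) (eps / (Rabs K + 1))); split.
{ apply Rmin_pos; [lra | apply Rdiv_lt_0_compat; lra]. }
intros w Hw.
assert (H1 : Cmod (w - z) < (1 - Cmod z) / 2) by (eapply Rlt_le_trans; [exact Hw | apply Rmin_l]).
assert (H2 : Cmod (w - z) < eps / (Rabs K + 1)) by (eapply Rlt_le_trans; [exact Hw | apply Rmin_r]).
assert (Hwrho : Cmod w <= rho).
{ replace w with (z + (w - z))%C by ring.
  eapply Rle_trans; [apply Cmod_triangle|]. unfold rho; lra. }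
set (h2 := Cmod (w - z) * Cmod (w - z)).
(* The derived series is written unshifted to match the other two; at k = 0 the factor [INR 0]
   cancels the spurious power [pred 0]. *)
assert (HT : is_series (fun k => a k * w ^ k + (- (a k * z ^ k) + - (w - z) * (INR k * a k * z ^ (pred k))))%C
  (CPS a w + (- CPS a z + - (w - z) * CPS (CPS_derive a) z))%C).
{ apply is_series_C_plus.
  { apply CPS_correct; [exact Ha | lra]. }
  apply is_series_C_plus.
  { exact (is_series_opp (K := C_AbsRing) (V := C_NormedModule) _ _ (CPS_correct a z Ha Hz)). }
  apply is_series_C_scal, is_series_C_decr.
  replace (CPS (CPS_derive a) z - INR 0 * a 0%nat * z ^ pred 0)%C
    with (CPS (CPS_derive a) z) by (simpl; ring).
  apply CPS_correct; [apply abs_conv_derive; exact Ha | exact Hz]. }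
assert (HMs : is_series (fun k => M k * h2) (K * h2)).
{ apply (is_series_ext (fun k => scal h2 (M k))); [intros; apply Rmult_comm|].
  rewrite Rmult_comm. apply (is_series_scal (K := R_AbsRing) (V := R_NormedModule)); exact HM. }
replace (CPS a w - CPS a z - (w - z) * CPS (CPS_derive a) z)%C
  with (CPS a w + (- CPS a z + - (w - z) * CPS (CPS_derive a) z))%C by ring.
apply Rle_trans with (K * h2).
- refine (Cmod_series_le _ _ _ _ HT _ HMs).
  intros [|[|k]].
  + replace (a 0%nat * w ^ 0 + (- (a 0%nat * z ^ 0) + - (w - z) * (INR 0 * a 0%nat * z ^ pred 0)))%C
      with (RtoC 0) by (simpl; ring).
    rewrite Cmod_0; simpl M; lra.
  + replace (a 1%nat * w ^ 1 + (- (a 1%nat * z ^ 1) + - (w - z) * (INR 1 * a 1%nat * z ^ pred 1)))%C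
      with (RtoC 0) by (simpl; ring).
    rewrite Cmod_0; simpl M; lra.
  + replace (a (S (S k)) * w ^ S (S k) + (- (a (S (S k)) * z ^ S (S k))
      + - (w - z) * (INR (S (S k)) * a (S (S k)) * z ^ pred (S (S k)))))%C
      with (a (S (S k)) * (w ^ S (S k) - z ^ S (S k) - INR (S (S k)) * z ^ S k * (w - z)))%C
      by (simpl pred; ring).
    rewrite Cmod_mult.
    assert (HB := Cpow_taylor_bound z w rho k ltac:(unfold rho; lra) Hwrho).
    apply Rle_trans with (Cmod (a (S (S k))) * (INR (S (S k)) * INR (S k) * rho ^ k * h2)).
    * apply Rmult_le_compat_l; [apply Cmod_ge_0 | exact HB].
    * right; unfold M; ring.
- unfold h2; rewrite <- Rmult_assoc. apply Rmult_le_compat_r; [apply Cmod_ge_0|].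
  apply Rle_trans with ((Rabs K + 1) * (eps / (Rabs K + 1))).
  + apply Rle_trans with (Rabs K * Cmod (w - z)).
    * apply Rmult_le_compat_r; [apply Cmod_ge_0 | apply Rle_abs].
    * apply Rmult_le_compat; try lra. apply Cmod_ge_0.
  + right; field; lra.
Qed.

Lemma holomorphic_CPS (a : nat -> C) : abs_conv a -> holomorphic (CPS a).
Proof.
intros Ha; exists (CPS (CPS_derive a)); intros z Hz; split.
- apply is_derive_CPS; assumption.
- eapply is_derive_C_continuous, is_derive_CPS; [apply abs_conv_derive|]; assumption.
Qed.

(** Abel's argument: at a real point s between r and 1 the terms tend to 0, so from some index on
    |a_k| s^k <= 1, and |a_k| r^k is dominated by (r/s)^k. *)
Lemma abs_conv_pseries (a : nat -> C) :
  (forall z, Cmod z < 1 -> exists l : C, is_pseries a z l) -> abs_conv a.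
Proof.
intros Hp r Hr.
pose (s := (r + 1) / 2).
assert (Hs : 0 < s < 1) by (unfold s; lra).
destruct (Hp s) as [l Hl]; [rewrite Cmod_R, Rabs_pos_eq; lra|].
apply is_pseries_C, is_series_C in Hl. destruct Hl as [H1 H2].
assert (E : forall k, Cmod (a k * s ^ k)%C = Cmod (a k) * s ^ k).
{ intros k; rewrite Cmod_mult, Cmod_pow, Cmod_R, Rabs_pos_eq; lra. }
assert (L1 := ex_series_lim_0 _ (ex_intro _ _ H1)).
assert (L2 := ex_series_lim_0 _ (ex_intro _ _ H2)).
assert (HB : exists N, forall k, (N <= k)%nat -> Cmod (a k) * s ^ k <= 1).
{ apply is_lim_seq_spec in L1; apply is_lim_seq_spec in L2.
  assert (Hh : 0 < / 2) by lra.
  destruct (L1 (mkposreal _ Hh)) as [N1 K1], (L2 (mkposreal _ Hh)) as [N2 K2].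
  exists (Nat.max N1 N2); intros k Hk; rewrite <- E.
  specialize (K1 k ltac:(lia)); specialize (K2 k ltac:(lia)).
  change (Rabs (Re (a k * s ^ k)%C - 0) < / 2) in K1.
  change (Rabs (Im (a k * s ^ k)%C - 0) < / 2) in K2.
  rewrite Rminus_0_r in K1, K2.
  set (w := (a k * s ^ k)%C) in *.
  rewrite (surjective_pairing w).
  eapply Rle_trans; [apply Cmod_le_abs|]. unfold Re, Im in K1, K2; lra. }
destruct HB as [N HN].
apply (ex_series_incr_n _ N).
assert (Hq : 0 <= r / s < 1).
{ split; [apply Rdiv_le_0_compat; lra|]. apply (Rmult_lt_reg_r s); [lra|].
  replace (r / s * s) with r by (field; lra). unfold s; lra. }
assert (G : ex_series (fun k => (r / s) ^ k)) by (apply ex_series_geom; rewrite Rabs_pos_eq; lra).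
apply (ex_series_incr_n _ N) in G.
refine (ex_series_le (K := R_AbsRing) (V := R_CompleteNormedModule) _ _ _ G).
intros k. set (m := (N + k)%nat).
change (Rabs (Cmod (a m) * r ^ m) <= (r / s) ^ m).
rewrite Rabs_pos_eq by (apply Rmult_le_pos; [apply Cmod_ge_0 | apply pow_le; lra]).
replace (Cmod (a m) * r ^ m) with (Cmod (a m) * s ^ m * (r / s) ^ m).
- rewrite <- (Rmult_1_l ((r / s) ^ m)) at 2. apply Rmult_le_compat_r; [apply pow_le; lra|].
  apply HN; unfold m; lia.
- rewrite Rmult_assoc, <- Rpow_mult_distr. f_equal; f_equal; field; lra.
Qed.

(** * Taylor coefficients of functions with real part bounded below *)

Lemma Re_conj (z : C) : Re (Cconj z) = Re z.
Proof. reflexivity. Qed.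

Lemma Cconj_mult (a b : C) : Cconj (a * b) = (Cconj a * Cconj b)%C.
Proof. apply injective_projections; simpl; ring. Qed.

Lemma Cmult_conj (z : C) : (z * Cconj z)%C = RtoC (Cmod z ^ 2).
Proof. rewrite <- Cmod2_conj, RtoC_pow; reflexivity. Qed.

Lemma Cpow_0_S (n : nat) : ((0 : C) ^ S n)%C = 0.
Proof. rewrite Cpow_S; ring. Qed.

Lemma le_at_1 (g : R -> R) (c : R) :
  continuity_pt g 1 -> (forall r, 0 < r < 1 -> g r <= c) -> g 1 <= c.
Proof.
intros Hg H. apply Rnot_lt_le; intros Hlt.
destruct (Hg (g 1 - c)) as [e [He K]]; [lra|].
pose (r := 1 - Rmin e 1 / 2).
assert (M : 0 < Rmin e 1) by (apply Rmin_pos; lra).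
assert (M1 : Rmin e 1 <= 1) by apply Rmin_r.
assert (M2 : Rmin e 1 <= e) by apply Rmin_l.
assert (Hr : 0 < r < 1) by (unfold r; lra).
assert (D : Rabs (g r - g 1) < g 1 - c).
{ apply K. split.
  - split; [exact I | lra].
  - change (Rabs (r - 1) < e). rewrite Rabs_minus_sym, Rabs_pos_eq; unfold r; lra. }
apply Rabs_def2 in D. specialize (H r Hr). lra.
Qed.

Lemma continuity_pt_pow (n : nat) (x : R) : continuity_pt (fun r => r ^ n) x.
Proof. apply derivable_continuous_pt, derivable_pt_pow. Qed.

Section Division.

(* [q k = d k + z q (k + 1)] says that [d] is the sequence of Taylor
   coefficients of [q 0] and the [q k] are the successive remainders. *)
Variables (q : nat -> C -> C) (d : nat -> C).
Hypothesis q_hol : forall k, holomorphic (q k).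
Hypothesis q_step : forall k z, Cmod z < 1 -> q k z = (d k + z * q (S k) z)%C.

Lemma remainder_at_0 (k : nat) : q k 0 = d k.
Proof. rewrite q_step; [ring | rewrite Cmod_0; lra]. Qed.

(* On [|z| = r] one has [conj z = r^2 / z], so that the terms of low degree can
   be reflected into nonnegative powers of [z] without changing real parts. *)
Lemma reflection (kappa : C) (r : R) (k m : nat) :
  0 <= r < 1 -> (m <= k)%nat ->
  exists T : C -> C, holomorphic T /\
    T 0 = (d k * (Cconj kappa * (r ^ S k * r ^ S k)%R))%C /\
    forall z, Cmod z = r ->
      Re (T z) = Re (q (k - m) z * z ^ S (k - m) * Cconj (kappa * z ^ S k))%C.
Proof.
intros Hr Hm; induction m as [|m IH].
(* For the last remainder the powers of z and conj z are equal and combine to r^(2(k+1)), so nothing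
   is left to reflect. Its value at 0 brings in [d k]; the later steps add only terms vanishing at
   0. *)
- exists (fun z => q k z * (Cconj kappa * (r ^ S k * r ^ S k)%R))%C; repeat split.
  + apply holomorphic_mult; [apply q_hol | apply holomorphic_const].
  + rewrite remainder_at_0; reflexivity.
  + intros z Hz. f_equal. rewrite Nat.sub_0_r, Cconj_mult.
    replace (q k z * z ^ S k * (Cconj kappa * Cconj (z ^ S k)))%C
      with (q k z * (Cconj kappa * (z ^ S k * Cconj (z ^ S k))))%C by ring.
    rewrite Cmult_conj, Cmod_pow, Hz. do 4 f_equal. simpl; ring.
- destruct IH as [T [HT [HT0 HTz]]]; [lia|].
  (* Passing from q_(j+1) to q_j adds d_j z^(j+1) conj (kappa z^(k+1)). Its conjugate has the same
     real part and equals conj d_j kappa r^(2(j+1)) z^(m+1) on the circle, since k + 1 = (j + 1) +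
     (m + 1). *)
  set (j := (k - S m)%nat).
  assert (Ej : (k - m)%nat = S j) by (unfold j; lia).
  rewrite Ej in HTz.
  exists (fun z => T z + (Cconj (d j) * kappa * (r ^ S j * r ^ S j)%R) * z ^ S m)%C; repeat split.
  + apply holomorphic_plus; [exact HT|].
    apply holomorphic_mult; [apply holomorphic_const | apply holomorphic_pow].
  + rewrite HT0, Cpow_0_S; ring.
  + intros z Hz. rewrite Re_plus, HTz by exact Hz.
    rewrite (q_step j) by lra.
    replace ((d j + z * q (S j) z) * z ^ S j * Cconj (kappa * z ^ S k))%C
      with (q (S j) z * z ^ S (S j) * Cconj (kappa * z ^ S k)
            + d j * z ^ S j * Cconj (kappa * z ^ S k))%C by (rewrite (Cpow_S z (S j)); ring).
    rewrite Re_plus; f_equal.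
    rewrite <- (Re_conj (d j * z ^ S j * _)%C), !Cconj_mult, !Cconj_conj.
    f_equal.
    replace (S k) with (S j + S m)%nat by (unfold j; lia).
    rewrite Cpow_add_r.
    replace (Cconj (d j) * Cconj (z ^ S j) * (kappa * (z ^ S j * z ^ S m)))%C
      with (Cconj (d j) * kappa * (z ^ S j * Cconj (z ^ S j)) * z ^ S m)%C by ring.
    rewrite Cmult_conj, Cmod_pow, Hz. do 3 f_equal. simpl; ring.
Qed.

Lemma Taylor_coef_bound_aux (c : R) (kappa : C) (r : R) (k : nat) :
  (forall z, Cmod z < 1 -> - c <= Re (z * q 0 z)%C) ->
  Cmod kappa = 1 -> 0 < r < 1 -> Re (d k * Cconj kappa)%C * r ^ S k <= 2 * c.
Proof.
intros HRe Hk Hr.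
destruct (reflection kappa r k k) as [T [HT [HT0 HTz]]]; [lra | lia |].
rewrite Nat.sub_diag in HTz.
set (rn := r ^ S k) in *.
assert (Prn : 0 < rn) by (apply pow_lt; lra).
(* With Q = z q_0 and zeta = kappa z^(k+1), one has 2 Re Q Re zeta = Re (Q zeta) + Re (Q conj zeta).
   The second product is not holomorphic and is replaced by [T], which has the same real part on the
   circle. Thus Re W = (Re Q + c) (r^(k+1) - Re zeta) there, while W(0) = c r^(k+1) - r^(2(k+1)) d_k
   conj kappa / 2. *)
pose (W := (fun z => (z * q 0%nat z + c) * rn + ((- (1 / 2))%R * T z
  + ((- (1 / 2))%R * (z * q 0%nat z) + (- c)%R) * (kappa * z ^ S k)))%C).
assert (HW : holomorphic W).
{ assert (HQ : holomorphic (fun z => z * q 0%nat z)%C)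
    by (apply holomorphic_mult; [apply holomorphic_id | apply q_hol]).
  apply holomorphic_plus.
  { apply holomorphic_mult; [|apply holomorphic_const].
    apply holomorphic_plus; [exact HQ | apply holomorphic_const]. }
  apply holomorphic_plus.
  { apply holomorphic_mult; [apply holomorphic_const | exact HT]. }
  apply holomorphic_mult.
  - apply holomorphic_plus; [|apply holomorphic_const].
    apply holomorphic_mult; [apply holomorphic_const | exact HQ].
  - apply holomorphic_mult; [apply holomorphic_const | apply holomorphic_pow]. }
assert (H0 : 0 <= Re (W 0)).
{ apply (Re_center_nonneg W r HW); [lra|].
  intros z Hz. unfold W.
  assert (HT1 := HTz z Hz).
  set (zeta := (kappa * z ^ S k)%C) in *.
  assert (Hzeta : Re zeta <= rn).
  { eapply Rle_trans; [apply Rle_abs|]. eapply Rle_trans; [apply re_le_Cmod|].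
    unfold zeta. rewrite Cmod_mult, Cmod_pow, Hk, Hz. unfold rn; lra. }
  assert (HQ : - c <= Re (z * q 0%nat z)%C) by (apply HRe; lra).
  replace (q 0%nat z * z ^ 1)%C with (z * q 0%nat z)%C in HT1 by (simpl; ring).
  set (Q := (z * q 0%nat z)%C) in *.
  rewrite !Re_plus, Re_scal, HT1.
  replace (Re ((Q + c) * rn)%C) with ((Re Q + c) * rn)
    by (destruct Q; unfold Re; simpl; ring).
  assert (E : Re (((- (1 / 2))%R * Q + (- c)%R) * zeta)%C
     = - (1 / 2) * Re (Q * zeta)%C - c * Re zeta)
    by (destruct Q, zeta; unfold Re; simpl; ring).
  rewrite E.
  assert (E2 : Re (Q * Cconj zeta)%C + Re (Q * zeta)%C = 2 * (Re Q * Re zeta))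
    by (destruct Q, zeta; unfold Re; simpl; ring).
  assert (0 <= (Re Q + c) * (rn - Re zeta)) by (apply Rmult_le_pos; lra).
  nra. }
assert (E0 : W 0 = (RtoC (c * rn) + (- (1 / 2) * (rn * rn))%R * (d k * Cconj kappa))%C).
{ unfold W; rewrite Cpow_0_S, HT0, !RtoC_mult; ring. }
rewrite E0, Re_plus, Re_scal in H0.
change (Re (c * rn)%R) with (c * rn) in H0.
apply Rmult_le_reg_l with (rn / 2); [lra|]. lra.
Qed.

(** Caratheodory's coefficient bound: take for kappa the phase of d_k, or 1 if d_k = 0, and let r
    tend to 1. *)
Lemma Taylor_coef_bound (c : R) (k : nat) :
  (forall z, Cmod z < 1 -> - c <= Re (z * q 0 z)%C) -> Cmod (d k) <= 2 * c.
Proof.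
intros HRe.
assert (H : exists kappa : C, Cmod kappa = 1 /\ (d k * Cconj kappa)%C = RtoC (Cmod (d k))).
{ destruct (Ceq_dec (d k) 0) as [E|E].
  - exists 1; split; [apply Cmod_1|]. rewrite E, Cmod_0; ring.
  - assert (P : 0 < Cmod (d k)) by (apply Cmod_gt_0; exact E).
    exists (RtoC (/ Cmod (d k)) * d k)%C; split.
    + rewrite Cmod_mult, Cmod_R, Rabs_pos_eq by (left; apply Rinv_0_lt_compat; exact P).
      field; lra.
    + rewrite Cconj_mult.
      replace (Cconj (RtoC (/ Cmod (d k)))) with (RtoC (/ Cmod (d k)))
        by (apply injective_projections; simpl; ring).
      replace (d k * ((/ Cmod (d k))%R * Cconj (d k)))%C
        with ((/ Cmod (d k))%R * (d k * Cconj (d k)))%C by ring.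
      rewrite Cmult_conj, <- RtoC_mult. f_equal. field; lra. }
destruct H as [kappa [H1 H2]].
replace (Cmod (d k)) with (Cmod (d k) * 1 ^ S k) by (rewrite pow1; ring).
apply (le_at_1 (fun r => Cmod (d k) * r ^ S k)).
- apply continuity_pt_mult; [apply continuity_pt_const; intros ? ?; reflexivity|].
  apply continuity_pt_pow.
- intros r Hr. assert (H := Taylor_coef_bound_aux c kappa r k HRe H1 Hr).
  rewrite H2 in H; exact H.
Qed.

End Division.

(** * Coefficients of functions in F *)

(** Long division of power series for b_0 = 1. Row k holds the coefficients of the k-th remainder (s
    - (c_0 + ... + c_(k-1) z^(k-1)) b) / z^k, and its head is the quotient coefficient c_k. *)
Fixpoint division (b s : nat -> C) (k : nat) : nat -> C :=
  match k with
  | O => s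
  | S j => fun i => (division b s j (S i) + - division b s j 0 * b (S i))%C
  end.

Lemma abs_conv_division (b s : nat -> C) (k : nat) :
  abs_conv b -> abs_conv s -> abs_conv (division b s k).
Proof.
intros Hb Hs; induction k as [|k IH]; [exact Hs|].
apply (abs_conv_linear (fun i => division b s k (S i)) (fun i => b (S i))).
- apply abs_conv_shift; exact IH.
- apply abs_conv_shift; exact Hb.
Qed.

Lemma CPS_division (b s : nat -> C) (k : nat) (z : C) :
  abs_conv b -> abs_conv s -> b 0%nat = 1 -> Cmod z < 1 ->
  CPS (division b s k) z
  = (division b s k 0 * CPS b z + z * CPS (division b s (S k)) z)%C.
Proof.
intros Hb Hs Hb0 Hz.
rewrite (CPS_decr (division b s k)) by (try apply abs_conv_division; assumption).
rewrite (CPS_decr b) by assumption.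
change (division b s (S k))
  with (fun i => division b s k (S i) + - division b s k 0 * b (S i))%C.
rewrite (CPS_linear (fun i => division b s k (S i)) (fun i => b (S i)));
  try apply abs_conv_shift; try apply abs_conv_division; try assumption.
rewrite Hb0; ring.
Qed.

(** The free index i is needed by the induction: a row at i refers to the previous row at i + 1. *)
Lemma division_sum_aux (b s : nat -> C) (k i : nat) :
  s (k + S i)%nat
  = (division b s (S k) i + sum_n (fun j => division b s j 0 * b (k + S i - j)%nat) k)%C.
Proof.
revert i; induction k as [|k IH]; intros i.
- rewrite sum_O, Nat.sub_0_r. simpl; ring.
- rewrite sum_Sn.
  replace (S k + S i)%nat with (k + S (S i))%nat by lia.
  rewrite (IH (S i)).
  replace (k + S (S i) - S k)%nat with (S i) by lia.
  change (division b s (S (S k)) i)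
    with (division b s (S k) (S i) + - division b s (S k) 0 * b (S i))%C.
  set (A := sum_n _ k). change (plus A) with (Cplus A). ring.
Qed.

Lemma division_sum (b s : nat -> C) (k : nat) :
  b 0%nat = 1 ->
  s k = sum_n (fun j => division b s j 0 * b (k - j)%nat)%C k.
Proof.
intros Hb0; destruct k as [|k].
- rewrite sum_O, Nat.sub_diag, Hb0. simpl; ring.
- rewrite sum_Sn. assert (H := division_sum_aux b s k 0).
  replace (k + 1)%nat with (S k) in H by lia. rewrite H, Nat.sub_diag, Hb0.
  set (A := sum_n _ k). change (plus A) with (Cplus A). ring.
Qed.

(* [d j] is the coefficient of [z^(j+1)] in [z f''(z) / f'(z)]. *)
Definition log_derivative_coefs (b d : nat -> C) : Prop :=
  b 0%nat = 1 /\
  (forall k, (INR (S k) * b (S k))%C = sum_n (fun j => d j * b (k - j)%nat)%C k) /\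
  forall k, Cmod (d k) <= 3.

Lemma class_F_coefs (f : C -> C) (a : nat -> C) :
  class_F f a -> exists d, log_derivative_coefs (CPS_derive a) d.
Proof.
intros [Hf [Ha0 [Ha1 [Hps [Hlu HRe]]]]].
set (b := CPS_derive a).
assert (Aa : abs_conv a) by (apply abs_conv_pseries; intros z Hz; exists (f z); apply Hps; exact Hz).
assert (Ab : abs_conv b) by (apply abs_conv_derive; exact Aa).
set (s := CPS_derive b).
assert (As : abs_conv s) by (apply abs_conv_derive; exact Ab).
assert (Ef : forall z, Cmod z < 1 -> CPS a z = f z).
{ intros z Hz. apply CPS_unique; try assumption. apply is_pseries_C, Hps; exact Hz. }
assert (D1 : forall z, Cmod z < 1 -> C_derive f z = CPS b z).
{ intros z Hz. apply is_C_derive_unique.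
  apply (is_C_derive_ext_disk (CPS a) f z _ 1 Hz Ef), is_derive_CPS; assumption. }
assert (D2 : forall z, Cmod z < 1 -> C_derive (C_derive f) z = CPS s z).
{ intros z Hz. apply is_C_derive_unique.
  apply (is_C_derive_ext_disk (CPS b) _ z _ 1 Hz); [intros; symmetry; apply D1; assumption|].
  apply is_derive_CPS; assumption. }
assert (Nz : forall z, Cmod z < 1 -> CPS b z <> 0)
  by (intros z Hz; rewrite <- D1 by exact Hz; apply Hlu; exact Hz).
assert (Hb0 : b 0%nat = 1) by (unfold b, CPS_derive; rewrite Ha1; simpl; ring).
exists (fun k => division b s k 0); split; [exact Hb0|]; split.
- intros k. rewrite <- (division_sum b s k Hb0). reflexivity.
- intros k. replace 3 with (2 * (3 / 2)) by field.
  (* Dividing the k-th remainder by f' turns the long division into the recursion q_k = d_k + z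
     q_(k+1), with z q_0 = z f''/f'. *)
  apply (Taylor_coef_bound (fun k z => CPS (division b s k) z * / CPS b z)%C
    (fun k => division b s k 0)).
  + intros j. apply holomorphic_mult.
    * apply holomorphic_CPS, abs_conv_division; assumption.
    * apply holomorphic_inv; [apply holomorphic_CPS; exact Ab | exact Nz].
  + intros j z Hz. rewrite (CPS_division b s j z) by assumption.
    field. apply Nz; exact Hz.
  + intros z Hz. specialize (HRe z Hz). rewrite D1, D2 in HRe by exact Hz.
    rewrite Re_plus in HRe. change (Re 1) with 1 in HRe.
    change (division b s 0) with s.
    unfold Cdiv in HRe. rewrite <- Cmult_assoc in HRe. lra.
Qed.

(** Triangular numbers sum to tetrahedral ones. Splitting off the term j = 0 leaves the sum for the
    preceding n. *)
Lemma sum_triangular (n : nat) :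
  sum_n (fun j => INR (S (n - j)) * INR (S (S (n - j))) / 2) n
  = INR (S n) * INR (S (S n)) * INR (S (S (S n))) / 6.
Proof.
induction n as [|n IH].
- rewrite sum_O; match goal with |- ?x = ?y => change (x = y :> R) end; simpl; field.
- unfold sum_n. rewrite sum_Sn_m by lia. rewrite <- sum_n_m_S.
  unfold sum_n in IH.
  change (sum_n_m (fun k => INR (S (S n - S k)) * INR (S (S (S n - S k))) / 2) 0 n)
    with (sum_n_m (fun j => INR (S (n - j)) * INR (S (S (n - j))) / 2) 0 n).
  rewrite IH, Nat.sub_0_r.
  match goal with |- plus ?x ?y = _ => change (plus x y) with (x + y)%R end.
  rewrite !S_INR; match goal with |- ?x = ?y => change (x = y :> R) end; field.
Qed.

Section Coefficients.

Variables b d : nat -> C.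
Hypothesis Hbd : log_derivative_coefs b d.

(** The bound solves the recurrence with every d_j equal to 3, that is, it lists the coefficients of
    (1 - z)^(-3); so the induction closes without loss. *)
Lemma coef_bound (n : nat) : Cmod (b n) <= INR (S n) * INR (S (S n)) / 2.
Proof.
destruct Hbd as [Hb0 [Hrec Hd]].
induction n as [n IH] using Wf_nat.lt_wf_ind.
destruct n as [|n]; [rewrite Hb0, Cmod_1; simpl; lra|].
assert (P : 0 < INR (S n)) by (apply lt_0_INR; lia).
apply Rmult_le_reg_l with (INR (S n)); [exact P|].
rewrite <- (Cmod_INR (S n)) at 1. rewrite <- Cmod_mult, Hrec.
eapply Rle_trans; [apply Cmod_sum_n_m|].
apply Rle_trans with (sum_n (fun j => scal 3 (INR (S (n - j)) * INR (S (S (n - j))) / 2)) n).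
- apply sum_n_m_le. intros j. rewrite Cmod_mult.
  apply Rmult_le_compat; try apply Cmod_ge_0; [apply Hd | apply IH; lia].
- rewrite (sum_n_scal_l (K := R_AbsRing) (V := R_NormedModule)), sum_triangular.
  match goal with |- scal ?x ?y <= _ => change (scal x y) with (x * y) end.
  right; field.
Qed.

Lemma coefs_low :
  b 1%nat = d 0%nat /\ (2 * b 2%nat = d 1%nat + d 0%nat * b 1%nat)%C /\
  (3 * b 3%nat = d 2%nat + d 1%nat * b 1%nat + d 0%nat * b 2%nat)%C /\
  (4 * b 4%nat = d 3%nat + d 2%nat * b 1%nat + d 1%nat * b 2%nat + d 0%nat * b 3%nat)%C.
Proof.
destruct Hbd as [Hb0 [Hrec Hd]].
assert (H0 := Hrec 0%nat); assert (H1 := Hrec 1%nat);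
  assert (H2 := Hrec 2%nat); assert (H3 := Hrec 3%nat).
rewrite sum_O in H0. rewrite sum_Sn, sum_O in H1.
rewrite !sum_Sn, sum_O in H2. rewrite !sum_Sn, sum_O in H3.
simpl Nat.sub in *. rewrite Hb0 in *.
replace (INR 1) with 1 in H0 by (simpl; ring).
replace (INR 2) with 2 in H1 by (simpl; ring).
replace (INR 3) with 3 in H2 by (simpl; ring).
replace (INR 4) with 4 in H3 by (simpl; ring).
repeat split.
- rewrite Cmult_1_l in H0. rewrite H0; ring.
- rewrite H1. change (@plus C_AbelianMonoid) with Cplus. ring.
- rewrite H2. change (@plus C_AbelianMonoid) with Cplus. ring.
- rewrite H3. change (@plus C_AbelianMonoid) with Cplus. ring.
Qed.

End Coefficients.

(** * Low-degree sections *)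

Lemma is_derive_section (a : nat -> C) (n : nat) (z : C) :
  a 1%nat = 1 ->
  is_derive (section a (S n)) z (sum_n (fun k => CPS_derive a k * z ^ k)%C n).
Proof.
intros Ha1; induction n as [|n IH].
- rewrite sum_O.
  replace (CPS_derive a 0 * z ^ 0)%C with (RtoC 1)
    by (unfold CPS_derive; rewrite Ha1; simpl; ring).
  apply (is_derive_ext (fun w : C => w)); [|apply is_C_derive_id].
  intros w; unfold section. rewrite sum_n_m_zero by lia.
  symmetry; apply Cplus_0_r.
- rewrite sum_Sn.
  apply (is_derive_ext (fun w => section a (S n) w + a (S (S n)) * w ^ S (S n))%C).
  + intros w; unfold section. rewrite (sum_n_Sm _ 2 (S n)) by lia.
    symmetry; apply Cplus_assoc.
  + apply is_C_derive_plus; [exact IH|].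
    replace (CPS_derive a (S n) * z ^ S n)%C
      with (0 * z ^ S (S n) + a (S (S n)) * (INR (S (S n)) * z ^ S n))%C
      by (unfold CPS_derive; ring).
    apply is_C_derive_mult; [apply is_C_derive_const | apply is_C_derive_pow].
Qed.

(** The subtracted term is the exact sum of the series beyond n. The constant 33/216 = 27/8 - 29/9
    is (1 - 1/3)^(-3) minus its first five terms. *)
Lemma sum_triangular_tail (n : nat) : (4 <= n)%nat ->
  sum_n_m (fun k => INR (S k) * INR (S (S k)) / 2 * (1 / 3) ^ k) 5 n
  = 33 / 216 - (1 / 3) ^ n * (INR n * INR n / 4 + 3 * INR n / 2 + 19 / 8).
Proof.
intros Hn; induction Hn as [|n Hn IH].
- rewrite sum_n_m_zero by lia. change (0 = 33 / 216 - (1 / 3) ^ 4 * (INR 4 * INR 4 / 4 + 3 * INR 4 / 2 + 19 / 8)).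
  simpl; field.
- rewrite sum_n_Sm, IH by lia.
  match goal with |- plus ?x ?y = _ => change (plus x y) with (x + y)%R end.
  rewrite !S_INR. simpl pow.
  match goal with |- ?x = ?y => change (x = y :> R) end. field.
Qed.

Lemma sum_triangular_tail_le (n : nat) : (4 <= n)%nat ->
  sum_n_m (fun k => INR (S k) * INR (S (S k)) / 2 * (1 / 3) ^ k) 5 n <= 33 / 216.
Proof.
intros Hn; rewrite sum_triangular_tail by exact Hn.
assert (0 <= (1 / 3) ^ n) by (apply pow_le; lra).
assert (P := pos_INR n).
assert (0 <= (1 / 3) ^ n * (INR n * INR n / 4 + 3 * INR n / 2 + 19 / 8))
  by (apply Rmult_le_pos; [assumption | nra]).
lra.
Qed.

Lemma Cmod_sq (z : C) : Cmod z * Cmod z = Re z * Re z + Im z * Im z.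
Proof. assert (H := Cmod2_alt z). simpl in H. lra. Qed.

Lemma Re_ge_Cmod (z : C) : - Cmod z <= Re z.
Proof. assert (H := re_le_Cmod z). apply Rabs_le_between in H. lra. Qed.

(** Used with t = (Im u)^2 and s = 1 - (Re u)^2: a bound affine in t over the disk |u| <= 1 reduces
    to two polynomial inequalities in Re u, one at each end. *)
Lemma affine_pos (A B s t : R) :
  0 <= t <= s -> 0 < A -> 0 < A + s * B -> 0 < A + t * B.
Proof. intros. destruct (Rle_lt_dec 0 B); nra. Qed.

Lemma Re_square (u : C) : Re (u * u)%C = Re u * Re u - Im u * Im u.
Proof. destruct u; unfold Re, Im; simpl; ring. Qed.

Lemma Re_cube (u : C) :
  Re (u * u * u)%C = Re u * Re u * Re u - 3 * Re u * (Im u * Im u).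
Proof. destruct u; unfold Re, Im; simpl; ring. Qed.

Lemma Re_fourth (u : C) :
  Re (u * u * u * u)%C = Re u * Re u * Re u * Re u
    - 6 * Re u * Re u * (Im u * Im u) + Im u * Im u * (Im u * Im u).
Proof. destruct u; unfold Re, Im; simpl; ring. Qed.

Lemma Cmod_sq_1_plus (u : C) :
  Cmod (1 + u) * Cmod (1 + u) = (1 + Re u) * (1 + Re u) + Im u * Im u.
Proof. rewrite Cmod_sq; destruct u; unfold Re, Im; simpl; ring. Qed.

(** The quadratic truncation of exp u is the factor of v / 2 in s_5'. *)
Lemma Cmod_sq_exp_2 (u : C) :
  Cmod (1 + u + (/ 2)%R * (u * u)) * Cmod (1 + u + (/ 2)%R * (u * u))
  = (1 + Re u + (Re u * Re u - Im u * Im u) / 2) * (1 + Re u + (Re u * Re u - Im u * Im u) / 2)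
    + Im u * Im u * ((1 + Re u) * (1 + Re u)).
Proof. rewrite Cmod_sq; destruct u; unfold Re, Im; simpl; field. Qed.

(* In the next three lemmas [u = d_0 z], [v = d_1 z^2], [w = d_2 z^3] and
   [p = d_3 z^4], and the complex number in the conclusion is [s_n'(z)]. *)
Lemma Re_section_3_derivative_pos (u v : C) :
  Cmod u <= 1 -> Cmod v <= 1 / 3 ->
  0 < Re (1 + u + (/ 2)%R * (v + u * u))%C.
Proof.
intros Hu Hv.
assert (Hv' := Re_ge_Cmod v).
assert (Hsq := Cmod_sq u). assert (Hu0 := Cmod_ge_0 u).
rewrite 2!Re_plus, Re_scal, Re_plus, Re_square. change (Re 1) with 1.
set (x := Re u) in *; set (y := Im u) in *.
assert (x * x + y * y <= 1) by nra.
(* With y^2 <= 1 - x^2 the real part is at least (x + 1/2)^2 + 1/12. *)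
assert (0 <= (x + / 2) * (x + / 2)) by apply Rle_0_sqr.
lra.
Qed.

Lemma Re_section_4_derivative_pos (u v w : C) :
  Cmod u <= 1 -> Cmod v <= 1 / 3 -> Cmod w <= 1 / 9 ->
  0 < Re (1 + u + (/ 2)%R * (u * u) + (/ 6)%R * (u * u * u)
          + (/ 2)%R * (v * (1 + u)) + (/ 3)%R * w)%C.
Proof.
intros Hu Hv Hw.
rewrite 5!Re_plus, !Re_scal, Re_square, Re_cube. change (Re 1) with 1.
assert (Hw' := Re_ge_Cmod w).
assert (Hv' := Re_ge_Cmod (v * (1 + u))). rewrite Cmod_mult in Hv'.
assert (H1 := Cmod_sq_1_plus u). assert (H10 := Cmod_ge_0 (1 + u)).
assert (Hvm : Cmod v * Cmod (1 + u) <= 1 / 3 * Cmod (1 + u))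
  by (apply Rmult_le_compat_r; assumption).
set (m := Cmod (1 + u)) in *.
(* AM-GM with a constant close to the value of [m] at the critical points makes
   the bound affine in [t = (Im u)^2]. *)
assert (Hm : m <= (m * m + 36 / 25) / (12 / 5)).
{ assert (0 <= (m - 6 / 5) * (m - 6 / 5)) by apply Rle_0_sqr. lra. }
assert (Hsq := Cmod_sq u). assert (Hu0 := Cmod_ge_0 u).
assert (Hu1 : Cmod u * Cmod u <= 1) by nra.
set (x := Re u) in *; set (t := Im u * Im u) in *.
assert (Ht : 0 <= t <= 1 - x * x) by (split; [apply Rle_0_sqr | lra]).
assert (Hx : -1 <= x <= 1) by nra.
assert (H : 0 < (1 + x + x * x / 2 + x * x * x / 6 - ((1 + x) * (1 + x) + 36 / 25) / (72 / 5) - 1 / 27)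
   + t * (- / 2 - x / 2 - 5 / 72)).
{ apply (affine_pos _ _ _ _ Ht); nra. }
lra.
Qed.

Lemma Re_section_5_derivative_gt (u v w p : C) :
  Cmod u <= 1 -> Cmod v <= 1 / 3 -> Cmod w <= 1 / 9 -> Cmod p <= 1 / 27 ->
  33 / 216 < Re (1 + u + (/ 2)%R * (u * u) + (/ 6)%R * (u * u * u) + (/ 24)%R * (u * u * u * u)
          + (/ 2)%R * (v * (1 + u + (/ 2)%R * (u * u))) + (/ 3)%R * (w * (1 + u))
          + (/ 8)%R * (v * v) + (/ 4)%R * p)%C.
Proof.
intros Hu Hv Hw Hp.
rewrite 8!Re_plus, !Re_scal, (Re_square u), Re_cube, Re_fourth. change (Re 1) with 1.
assert (Hp' := Re_ge_Cmod p).
assert (Hv2 := Re_ge_Cmod (v * v)). rewrite Cmod_mult in Hv2.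
assert (Hvv : Cmod v * Cmod v <= 1 / 3 * (1 / 3))
  by (apply Rmult_le_compat; try apply Cmod_ge_0; assumption).
assert (H1 := Cmod_sq_1_plus u). assert (H2 := Cmod_sq_exp_2 u).
set (e2 := (1 + u + (/ 2)%R * (u * u))%C) in *. set (e1 := (1 + u)%C) in *.
assert (Hv' := Re_ge_Cmod (v * e2)). rewrite Cmod_mult in Hv'.
assert (Hw' := Re_ge_Cmod (w * e1)). rewrite Cmod_mult in Hw'.
assert (Hvm : Cmod v * Cmod e2 <= 1 / 3 * Cmod e2)
  by (apply Rmult_le_compat_r; [apply Cmod_ge_0 | assumption]).
assert (Hwm : Cmod w * Cmod e1 <= 1 / 9 * Cmod e1)
  by (apply Rmult_le_compat_r; [apply Cmod_ge_0 | assumption]).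
set (m := Cmod e1) in *. set (n := Cmod e2) in *.
assert (Hm : m <= (m * m + 1) / 2).
{ assert (0 <= (m - 1) * (m - 1)) by apply Rle_0_sqr. lra. }
(* AM-GM around 1/2, chosen to make the bound affine in t = (Im u)^2: the term -n^2/6 contributes
   -t^2/24, which cancels the t^2/24 coming from Re u^4 / 24. *)
assert (Hn : n <= n * n + 1 / 4).
{ assert (0 <= (n - 1 / 2) * (n - 1 / 2)) by apply Rle_0_sqr. lra. }
assert (Hsq := Cmod_sq u). assert (Hu0 := Cmod_ge_0 u).
assert (Hu1 : Cmod u * Cmod u <= 1) by nra.
set (x := Re u) in *; set (t := Im u * Im u) in *.
assert (Ht : 0 <= t <= 1 - x * x) by (split; [apply Rle_0_sqr | lra]).
assert (Hx : -1 <= x <= 1) by nra.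
assert (H : 0 < (1 + x + x * x / 2 + x * x * x / 6 + x * x * x * x / 24
     - ((1 + x + x * x / 2) * (1 + x + x * x / 2) + 1 / 4) / 6
     - ((1 + x) * (1 + x) + 1) / 54 - 1 / 72 - 1 / 108 - 33 / 216)
   + t * (- / 2 - x / 2 - x * x / 4 + (1 + x + x * x / 2) / 6 - (1 + x) * (1 + x) / 6 - 1 / 54)).
{ apply (affine_pos _ _ _ _ Ht).
  - nra.
  - nra. }
lra.
Qed.

(** * Sections in the disk of radius 1/3 *)

Lemma sum_n_C_Sn (u : nat -> C) (n : nat) : sum_n u (S n) = (sum_n u n + u (S n))%C.
Proof. exact (sum_Sn (G := C_AbelianMonoid) u n). Qed.

Lemma Re_section_derivative_pos (b d : nat -> C) (n : nat) (z : C) :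
  log_derivative_coefs b d -> Cmod z < 1 / 3 ->
  0 < Re (sum_n (fun k => b k * z ^ k)%C n).
Proof.
intros Hbd Hz.
destruct (coefs_low b d Hbd) as [E1 [E2 [E3 E4]]].
assert (Hcoef := coef_bound b d Hbd).
destruct Hbd as [Hb0 [_ Hd]].
assert (Hz0 := Cmod_ge_0 z).
set (u := (d 0%nat * z)%C). set (v := (d 1%nat * z ^ 2)%C).
set (w := (d 2%nat * z ^ 3)%C). set (p := (d 3%nat * z ^ 4)%C).
assert (Hpow : forall j, Cmod (d j * z ^ S j) <= 3 * (1 / 3) ^ S j).
{ intros j. rewrite Cmod_mult, Cmod_pow.
  apply Rmult_le_compat; try apply Cmod_ge_0; [apply pow_le; lra | apply Hd |].
  apply pow_incr; lra. }
(* Strictness is used for s_2' = 1 + u, which has no slack at |u| = 1; the other sections are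
   content with |u| <= 1. *)
assert (Hu1 : Cmod u < 1).
{ unfold u. rewrite Cmod_mult. assert (H := Hd 0%nat). nra. }
assert (Hu : Cmod u <= 1) by lra.
assert (Hv : Cmod v <= 1 / 3) by (eapply Rle_trans; [apply Hpow | simpl; lra]).
assert (Hw : Cmod w <= 1 / 9) by (eapply Rle_trans; [apply Hpow | simpl; lra]).
assert (Hp : Cmod p <= 1 / 27) by (eapply Rle_trans; [apply Hpow | simpl; lra]).
assert (F2 : b 2%nat = ((/ 2)%R * (d 1%nat + d 0%nat * b 1%nat))%C).
{ rewrite <- E2, RtoC_inv by lra. field. }
assert (F3 : b 3%nat = ((/ 3)%R * (d 2%nat + d 1%nat * b 1%nat + d 0%nat * b 2%nat))%C).
{ rewrite <- E3, RtoC_inv by lra. field. }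
assert (F4 : b 4%nat = ((/ 4)%R * (d 3%nat + d 2%nat * b 1%nat + d 1%nat * b 2%nat + d 0%nat * b 3%nat))%C).
{ rewrite <- E4, RtoC_inv by lra. field. }
assert (S0 : sum_n (fun k => b k * z ^ k)%C 0 = RtoC 1 :> C) by (rewrite sum_O, Hb0; simpl; ring).
assert (S1 : sum_n (fun k => b k * z ^ k)%C 1 = (1 + u)%C :> C)
  by (rewrite sum_n_C_Sn, S0, E1; unfold u; simpl; ring).
assert (S2 : sum_n (fun k => b k * z ^ k)%C 2 = (1 + u + (/ 2)%R * (v + u * u))%C :> C)
  by (rewrite sum_n_C_Sn, S1, F2, E1; unfold u, v; simpl; ring).
assert (S3 : sum_n (fun k => b k * z ^ k)%C 3
  = (1 + u + (/ 2)%R * (u * u) + (/ 6)%R * (u * u * u)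
          + (/ 2)%R * (v * (1 + u)) + (/ 3)%R * w)%C :> C).
{ rewrite sum_n_C_Sn, S2, F3, F2, E1, !RtoC_inv by lra.
  unfold u, v, w; simpl Cpow; field. }
assert (S4 : sum_n (fun k => b k * z ^ k)%C 4
  = (1 + u + (/ 2)%R * (u * u) + (/ 6)%R * (u * u * u) + (/ 24)%R * (u * u * u * u)
          + (/ 2)%R * (v * (1 + u + (/ 2)%R * (u * u))) + (/ 3)%R * (w * (1 + u))
          + (/ 8)%R * (v * v) + (/ 4)%R * p)%C :> C).
{ rewrite sum_n_C_Sn, S3, F4, F3, F2, E1, !RtoC_inv by lra.
  unfold u, v, w, p; simpl Cpow; field. }
destruct n as [|[|[|[|n]]]].
- rewrite S0; simpl; lra.
- rewrite S1, Re_plus. change (Re 1) with 1. assert (H := Re_ge_Cmod u). lra.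
- rewrite S2. apply Re_section_3_derivative_pos; assumption.
- rewrite S3. apply Re_section_4_derivative_pos; assumption.
- assert (Hn : (4 <= S (S (S (S n))))%nat) by lia.
  set (N := S (S (S (S n)))) in *. clearbody N.
  (* The sum up to index 4 is s_5'; for N = 4 the tail is an empty sum. *)
  unfold sum_n. rewrite (sum_n_m_Chasles _ 0 4 N) by lia.
  change (sum_n_m (fun k => b k * z ^ k)%C 0 4) with (sum_n (fun k => b k * z ^ k)%C 4).
  rewrite S4.
  set (tail := sum_n_m _ 5 N).
  assert (Htail : Cmod tail <= 33 / 216).
  { eapply Rle_trans; [|apply (sum_triangular_tail_le N Hn)].
    eapply Rle_trans; [apply Cmod_sum_n_m|]. apply sum_n_m_le; intros k.
    rewrite Cmod_mult, Cmod_pow.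
    apply Rmult_le_compat; [apply Cmod_ge_0 | apply pow_le; lra | apply Hcoef |].
    apply pow_incr; lra. }
  assert (Ht := Re_ge_Cmod tail).
  assert (H5 := Re_section_5_derivative_gt u v w p Hu Hv Hw Hp).
  match goal with |- 0 < Re (plus ?x tail) => change (0 < Re x + Re tail); set (s4 := x) in * end.
  lra.
Qed.

Lemma C_derive_section (a : nat -> C) (n : nat) (z : C) :
  a 1%nat = 1 -> (1 <= n)%nat ->
  C_derive (section a n) z = sum_n (fun k => CPS_derive a k * z ^ k)%C (n - 1).
Proof.
intros Ha Hn. apply is_C_derive_unique.
replace n with (S (n - 1)) at 1 by lia. apply is_derive_section; exact Ha.
Qed.

Lemma C_derive_section_correct (a : nat -> C) (n : nat) (z : C) :
  a 1%nat = 1 -> (1 <= n)%nat ->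
  is_derive (section a n) z (C_derive (section a n) z).
Proof.
intros Ha Hn. rewrite C_derive_section by assumption.
replace n with (S (n - 1)) at 1 by lia. apply is_derive_section; exact Ha.
Qed.

Lemma Re_C_derive_section_pos (f : C -> C) (a : nat -> C) (n : nat) (z : C) :
  class_F f a -> (1 <= n)%nat -> Cmod z < 1 / 3 -> 0 < Re (C_derive (section a n) z).
Proof.
intros Hf Hn Hz. destruct (class_F_coefs f a Hf) as [d Hd].
rewrite C_derive_section by (try apply Hf; exact Hn).
apply (Re_section_derivative_pos _ d); assumption.
Qed.

Lemma convex_class_id : convex_class (fun z => z).
Proof.
assert (Hd : forall z, is_derive (fun w : C => w) z (1 : C)) by apply is_C_derive_id.
split; [split; [|split]|split].
- intros z _; exists (1 : C); apply Hd.
- reflexivity.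
- apply is_C_derive_unique, Hd.
- intros z w _ _ E; exact E.
- intros u v t [z [Hz ->]] [w [Hw ->]] Ht.
  eexists; split; [|reflexivity].
  eapply Rle_lt_trans; [apply Cmod_triangle|].
  rewrite !Cmod_mult, !Cmod_R, !Rabs_pos_eq by lra.
  assert (P := Cmod_ge_0 z); assert (P' := Cmod_ge_0 w).
  destruct (Req_dec t 0); nra.
Qed.

Lemma section_0 (a : nat -> C) (n : nat) : section a n 0 = 0.
Proof.
unfold section.
replace (sum_n_m (fun k => a k * (0 : C) ^ k)%C 2 n) with (RtoC 0); [ring|].
symmetry. rewrite (sum_n_m_ext_loc _ (fun _ => zero)).
- apply (sum_n_m_const_zero (G := C_AbelianMonoid)).
- intros [|k] Hk; [lia|]. rewrite Cpow_0_S. apply Cmult_0_r.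
Qed.

Lemma C_derive_section_0 (a : nat -> C) (n : nat) :
  a 1%nat = 1 -> (1 <= n)%nat -> C_derive (section a n) 0 = 1.
Proof.
intros Ha Hn. rewrite C_derive_section by assumption.
induction (n - 1)%nat as [|m IH].
- rewrite sum_O. unfold CPS_derive. rewrite Ha; simpl; ring.
- rewrite sum_n_C_Sn, IH, Cpow_0_S; ring.
Qed.

Lemma normalized_section (a : nat -> C) (n : nat) (r : R) :
  a 1%nat = 1 -> (1 <= n)%nat -> normalized_in r (section a n).
Proof.
intros Ha Hn; split; [|split].
- intros z _; eexists; apply C_derive_section_correct; assumption.
- apply section_0.
- apply C_derive_section_0; assumption.
Qed.

Lemma is_derive_rescale (r : R) (f : C -> C) (z l : C) :
  r <> 0 -> is_derive f (r * z)%C l -> is_derive (fun w : C => / r * f (r * w))%C z l.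
Proof.
intros Hr Hf.
assert (Hr' : RtoC r <> 0) by (intros E; apply Hr, RtoC_inj; exact E).
replace l with (0 * f (r * z) + / r * ((0 * z + r * 1) * l))%C by (field; exact Hr').
apply (is_C_derive_mult (fun _ => / r)%C (fun w => f (r * w))%C); [apply is_C_derive_const|].
apply (is_C_derive_comp f (fun w => r * w)%C); [exact Hf|].
apply (is_C_derive_mult (fun _ => RtoC r) (fun w => w));
  [apply is_C_derive_const | apply is_C_derive_id].
Qed.

Lemma close_to_convex_of_Re_derivative_pos (r : R) (f : C -> C) :
  0 < r -> normalized_in r f ->
  (forall z, Cmod z < r -> 0 < Re (C_derive f z)) -> close_to_convex_in r f.
Proof.
intros Hr [Hf [Hf0 Hf1]] HRe; split; [repeat split; assumption|].
assert (Hrz : forall z, Cmod z < 1 -> Cmod (r * z) < r).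
{ intros z Hz. rewrite Cmod_mult, Cmod_R, Rabs_pos_eq by lra. nra. }
assert (Hd : forall z, Cmod z < 1 ->
  is_derive (fun w : C => / r * f (r * w))%C z (C_derive f (r * z)%C)).
{ intros z Hz. apply is_derive_rescale; [lra|].
  apply C_derive_correct; [exact 0|]. apply Hf, Hrz; exact Hz. }
assert (H0 : Cmod 0 < 1) by (rewrite Cmod_0; lra).
split; [split; [|split]|].
- intros z Hz; eexists; apply Hd; exact Hz.
- rewrite Cmult_0_r, Hf0; apply Cmult_0_r.
- rewrite (is_C_derive_unique _ _ _ (Hd 0 H0)), Cmult_0_r; exact Hf1.
- exists (fun z => z), 0; split; [apply convex_class_id|]; split.
  + rewrite Rabs_R0. assert (P := PI_RGT_0); lra.
  + intros z Hz.
    rewrite (is_C_derive_unique _ _ _ (Hd z Hz)), (is_C_derive_unique _ _ _ (is_C_derive_id z)).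
    rewrite cos_0, sin_0. change (1, 0)%R with (RtoC 1).
    replace (1 * (C_derive f (r * z) / 1))%C with (C_derive f (r * z))
      by (field; intros E; apply RtoC_inj in E; lra).
    apply HRe, Hrz; exact Hz.
Qed.

(** * Sharpness *)

Lemma one_minus_neq_0 (z : C) : Cmod z < 1 -> (1 - z)%C <> 0.
Proof.
intros Hz E. assert (Ez : z = 1) by (replace z with (1 - (1 - z))%C by ring; rewrite E; ring).
rewrite Ez, Cmod_1 in Hz; lra.
Qed.

Lemma is_derive_geometric (z : C) :
  Cmod z < 1 -> is_derive (fun w : C => / (1 - w))%C z (/ (1 - z) * / (1 - z))%C.
Proof.
intros Hz.
replace (/ (1 - z) * / (1 - z))%C
  with ((0 + (0 * z + - (1) * 1)) * - (/ (1 - z) * / (1 - z)))%C by ring.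
apply (is_C_derive_comp Cinv (fun w => 1 - w)%C).
- apply is_C_derive_inv, one_minus_neq_0; exact Hz.
- apply (is_derive_ext (fun w : C => 1 + - (1) * w)%C);
  [intros w; change (1 + - (1) * w = 1 - w)%C; ring|].
  apply is_C_derive_plus; [apply is_C_derive_const|].
  apply (is_C_derive_mult (fun _ => - (1))%C (fun w => w));
    [apply is_C_derive_const | apply is_C_derive_id].
Qed.

Lemma abs_conv_one : abs_conv (fun _ => 1).
Proof.
intros r Hr.
apply (ex_series_ext (fun k => r ^ k)).
- intros k; rewrite Cmod_1; symmetry; apply Rmult_1_l.
- apply ex_series_geom. rewrite Rabs_pos_eq; lra.
Qed.

(** A constant sequence is its own shift, so the sum s satisfies s = 1 + z s. *)
Lemma CPS_one (z : C) : Cmod z < 1 -> CPS (fun _ => 1) z = (/ (1 - z))%C.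
Proof.
intros Hz. assert (H := CPS_decr _ z abs_conv_one Hz). cbv beta in H.
set (s := CPS (fun _ => 1) z) in *.
assert (E : ((1 - z) * s)%C = 1) by (replace ((1 - z) * s)%C with (s - z * s)%C by ring; rewrite H at 1; ring).
replace s with (/ (1 - z) * ((1 - z) * s))%C by (field; apply one_minus_neq_0; exact Hz).
rewrite E; ring.
Qed.

Lemma CPS_derive_one (z : C) :
  Cmod z < 1 -> CPS (CPS_derive (fun _ => 1)) z = (/ (1 - z) * / (1 - z))%C.
Proof.
intros Hz.
rewrite <- (is_C_derive_unique _ _ _ (is_derive_CPS _ z abs_conv_one Hz)).
apply is_C_derive_unique.
apply (is_C_derive_ext_disk (fun w : C => / (1 - w))%C _ z _ 1 Hz).
- intros w Hw; symmetry; apply CPS_one; exact Hw.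
- apply is_derive_geometric; exact Hz.
Qed.

(** The primitive of (1 - z)^(-3) vanishing at 0. The constant -1/2 removes the term of degree 0 of
    (1 - z)^(-2) / 2, hence the separate case in [extremal_coef]. *)
Definition extremal (z : C) : C := ((/ 2)%R * (/ (1 - z) * / (1 - z)) + (- / 2)%R)%C.

Definition extremal_coef (k : nat) : C :=
  (match k with O => 0 | S _ => (/ 2)%R * INR (S k) end)%C.

Lemma is_derive_extremal (z : C) : Cmod z < 1 ->
  is_derive extremal z (/ (1 - z) * / (1 - z) * / (1 - z))%C.
Proof.
intros Hz. assert (D := is_derive_geometric z Hz).
set (g := (/ (1 - z))%C) in *.
replace (g * g * g)%C with (0 * (g * g) + (/ 2)%R * (g * g * g + g * (g * g)) + 0)%C
  by (rewrite RtoC_inv by lra; field).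
apply is_C_derive_plus; [|apply is_C_derive_const].
apply (is_C_derive_mult (fun _ => RtoC (/ 2)) (fun w => / (1 - w) * / (1 - w))%C);
  [apply is_C_derive_const|].
exact (is_C_derive_mult _ _ _ _ _ D D).
Qed.

Lemma is_derive_extremal_2 (z : C) : Cmod z < 1 ->
  is_derive (C_derive extremal) z (3 * (/ (1 - z) * / (1 - z) * / (1 - z) * / (1 - z)))%C.
Proof.
intros Hz. assert (D := is_derive_geometric z Hz).
apply (is_C_derive_ext_disk (fun w : C => / (1 - w) * / (1 - w) * / (1 - w))%C _ z _ 1 Hz).
- intros w Hw; symmetry; apply is_C_derive_unique, is_derive_extremal; exact Hw.
- set (g := (/ (1 - z))%C) in *.
  replace (3 * (g * g * g * g))%C with ((g * g * g + g * (g * g)) * g + g * g * (g * g))%C by ring.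
  exact (is_C_derive_mult _ _ _ _ _ (is_C_derive_mult _ _ _ _ _ D D) D).
Qed.

Lemma is_pseries_extremal (z : C) : Cmod z < 1 -> is_pseries extremal_coef z (extremal z).
Proof.
intros Hz. apply is_pseries_C, is_series_C_decr.
pose (c := CPS_derive (fun _ => 1)).
assert (Hc : abs_conv c) by (apply abs_conv_derive, abs_conv_one).
assert (H := CPS_decr c z Hc Hz).
unfold c at 1 in H; rewrite CPS_derive_one in H by exact Hz.
assert (Ec : c 0%nat = 1) by (unfold c, CPS_derive; simpl; ring).
rewrite Ec in H. unfold extremal; rewrite H.
replace ((/ 2)%R * (1 + z * CPS (fun k => c (S k)) z) + (- / 2)%R - extremal_coef 0 * z ^ 0)%C
  with ((/ 2)%R * z * CPS (fun k => c (S k)) z)%C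
  by (rewrite RtoC_opp; simpl; ring).
assert (K := is_series_C_scal ((/ 2)%R * z)%C _ _ (CPS_correct _ z (abs_conv_shift c Hc) Hz)).
revert K; apply is_series_ext. intros k.
unfold c, CPS_derive, extremal_coef. rewrite Cpow_S.
match goal with |- ?x = ?y => change (x = y :> C) end. ring.
Qed.

(** Equivalent to 2 (1 - Re z) - |1 - z|^2 = 1 - |z|^2 > 0. It gives the condition of F for
    [extremal], where 1 + z f''/f' = -2 + 3 / (1 - z). *)
Lemma Re_inv_one_minus (z : C) : Cmod z < 1 -> 1 / 2 < Re (/ (1 - z))%C.
Proof.
intros Hz. assert (Hw := one_minus_neq_0 z Hz).
assert (P : 0 < Cmod (1 - z)) by (apply Cmod_gt_0; exact Hw).
assert (H := Cmod_sq z). assert (H0 := Cmod_ge_0 z).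
assert (H1 := Cmod_sq (1 - z)).
rewrite Re_minus, Im_minus in H1. change (Re 1) with 1 in H1. change (Im 1) with 0 in H1.
assert (E : Re (/ (1 - z))%C = (1 - Re z) / (Cmod (1 - z) * Cmod (1 - z))).
{ rewrite H1. destruct z as [x y]; unfold Re, Im; simpl. f_equal; ring. }
rewrite E. apply (Rmult_lt_reg_r (Cmod (1 - z) * Cmod (1 - z)));
  [apply Rmult_lt_0_compat; exact P|].
replace ((1 - Re z) / (Cmod (1 - z) * Cmod (1 - z)) * (Cmod (1 - z) * Cmod (1 - z)))
  with (1 - Re z) by (field; lra).
nra.
Qed.

Lemma class_F_extremal : class_F extremal extremal_coef.
Proof.
split; [|split; [|split; [|split; [|split]]]].
- intros z Hz; eexists; apply is_derive_extremal; exact Hz.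
- reflexivity.
- simpl. rewrite <- RtoC_mult. f_equal; field.
- apply is_pseries_extremal.
- intros z Hz. rewrite (is_C_derive_unique _ _ _ (is_derive_extremal z Hz)).
  assert (N := one_minus_neq_0 z Hz).
  assert (N' : (/ (1 - z))%C <> 0).
  { intros E; apply R1_neq_R0, RtoC_inj.
    rewrite <- (Cinv_r _ N), E; ring. }
  repeat apply Cmult_neq_0; exact N'.
- intros z Hz.
  rewrite (is_C_derive_unique _ _ _ (is_derive_extremal_2 z Hz)),
    (is_C_derive_unique _ _ _ (is_derive_extremal z Hz)).
  assert (N := one_minus_neq_0 z Hz).
  replace (1 + z * (3 * (/ (1 - z) * / (1 - z) * / (1 - z) * / (1 - z)))
      / (/ (1 - z) * / (1 - z) * / (1 - z)))%C
    with ((- (2))%R + 3 * / (1 - z))%C by (rewrite RtoC_opp; field; exact N).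
  rewrite Re_plus, Re_scal. change (Re (- (2))%R) with (- (2)).
  assert (H := Re_inv_one_minus z Hz). lra.
Qed.

Lemma is_derive_section_extremal (z : C) :
  is_derive (section extremal_coef 2) z (1 + 3 * z)%C.
Proof.
replace (1 + 3 * z)%C with (sum_n (fun k => CPS_derive extremal_coef k * z ^ k)%C 1).
- apply is_derive_section. apply class_F_extremal.
- rewrite sum_n_C_Sn, sum_O. unfold CPS_derive, extremal_coef.
  rewrite RtoC_inv by lra. simpl INR. rewrite !RtoC_plus.
  match goal with |- ?x = ?y => change (x = y :> C) end.
  simpl Cpow; field.
Qed.

Lemma C_derive_section_extremal_zero : C_derive (section extremal_coef 2) (- (1 / 3))%R = 0.
Proof.
rewrite (is_C_derive_unique _ _ _ (is_derive_section_extremal _)).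
rewrite <- RtoC_mult, <- RtoC_plus. f_equal; field.
Qed.

Lemma Cmod_opp_third : Cmod (- (1 / 3))%R = 1 / 3.
Proof. rewrite Cmod_R, Rabs_Ropp, Rabs_pos_eq; lra. Qed.

(** At a critical point the quotient of derivatives is 0, so its real part is not positive, whatever
    g and alpha are. *)
Lemma not_close_to_convex_of_critical_point (r : R) (f : C -> C) (z : C) :
  0 < r -> Cmod z < r -> is_derive f z (0 : C) -> ~ close_to_convex_in r f.
Proof.
intros Hr Hz Hf [_ [_ [g [alpha [_ [_ H]]]]]].
assert (Hr' : RtoC r <> 0) by (intros E; apply RtoC_inj in E; lra).
assert (Hw : Cmod (z / r) < 1).
{ rewrite Cmod_div, Cmod_R, Rabs_pos_eq by (try exact Hr'; lra).
  apply (Rmult_lt_reg_r r); [exact Hr|]. replace (Cmod z / r * r) with (Cmod z)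
    by (field; lra). lra. }
specialize (H (z / r)%C Hw).
assert (Ez : (r * (z / r))%C = z) by (field; exact Hr').
assert (D : is_derive (fun w : C => / r * f (r * w))%C (z / r)%C (0 : C))
  by (apply is_derive_rescale; [lra | rewrite Ez; exact Hf]).
rewrite (is_C_derive_unique _ _ _ D) in H. unfold Cdiv in H.
rewrite Cmult_0_l, Cmult_0_r in H. simpl in H; lra.
Qed.

Theorem theorem1 :
  (forall (f : C -> C) (a : nat -> C) (n : nat),
     class_F f a -> (1 <= n)%nat ->
     forall z : C, Cmod z < 1 / 3 -> 0 < Re (C_derive (section a n) z))
  /\
  (forall (f : C -> C) (a : nat -> C) (n : nat),
     class_F f a -> (1 <= n)%nat ->
     close_to_convex_in (1 / 3) (section a n))
  /\
  (forall r : R, 1 / 3 < r <= 1 ->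
     ~ (forall (f : C -> C) (a : nat -> C) (n : nat),
          class_F f a -> (1 <= n)%nat ->
          forall z : C, Cmod z < r -> 0 < Re (C_derive (section a n) z))
     /\
     ~ (forall (f : C -> C) (a : nat -> C) (n : nat),
          class_F f a -> (1 <= n)%nat ->
          close_to_convex_in r (section a n))).
Proof.
split; [|split].
- intros f a n Hf Hn z Hz. exact (Re_C_derive_section_pos f a n z Hf Hn Hz).
- intros f a n Hf Hn. apply close_to_convex_of_Re_derivative_pos; [lra | |].
  + apply normalized_section; [apply Hf | exact Hn].
  + intros z Hz. exact (Re_C_derive_section_pos f a n z Hf Hn Hz).
- intros r Hr; split; intros H.
  + specialize (H _ _ 2%nat class_F_extremal ltac:(lia) (- (1 / 3))%R).
    rewrite Cmod_opp_third, C_derive_section_extremal_zero in H.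
    specialize (H (proj1 Hr)). simpl in H; lra.
  + specialize (H _ _ 2%nat class_F_extremal ltac:(lia)). revert H.
    apply (not_close_to_convex_of_critical_point _ _ (- (1 / 3))%R);
      [lra | rewrite Cmod_opp_third; lra |].
    rewrite <- C_derive_section_extremal_zero.
    apply C_derive_section_correct; [apply class_F_extremal | lia].
Qed.
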